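(* Let $(A,G,\alpha)$ be a $C^*$-dynamical system with $A$ unital and $G$ a one-parameter (i.e. one-dimensional) Lie group with Lie algebra $\mathfrak g=\mathbb R X$, let $\delta=\delta_X$ be the associated derivation of $A^\infty$, and let $\tau$ be a finite $G$-invariant trace on $A$. Then for every unitary $u\in M_n(A^\infty)$, the Chern-Connes character of $[u]_1\in K_1(A)$ is $$ch_\tau([u]_1)=\frac{1}{2\pi i}\,\tau\big(u^*\delta(u)\big),$$ where $H^1(\mathfrak g)=\mathfrak g^*$ is identified with the scalars through the basis dual to $X$.
   Context: A $C^*$-dynamical system $(A,G,\alpha)$ consists of a unital $C^*$-algebra $A$, a Lie group $G$ and a homomorphism $\alpha:G\to \mathrm{Aut}(A)$ such that $g\mapsto\alpha_g(a)$ is norm continuous for each $a\in A$. $A^\infty=\{a\in A: g\mapsto \alpha_g(a)\text{ is }C^\infty\}$; the inclusion $A^\infty\hookrightarrow A$ induces isomorphisms on $K_0,K_1$. For $X\in\mathfrak g$ (the Lie algebra of $G$) and $a\in A^\infty$, $\delta_X(a)=\lim_{t\to0}\frac{\alpha_{g_t}(a)-a}{t}$ with $g_t=\exp(tX)$; $\alpha$ and $\delta$ are extended entrywise to matrices. A finite $G$-invariant trace is a continuous positive linear functional $\tau:A\to\mathbb C$ with $\tau(ab)=\tau(ba)$ and $\tau(\alpha_g(a))=\tau(a)$; it is extended to $M_n(A)$ by composing with the usual matrix trace. $\Omega=A^\infty\otimes\Lambda\mathfrak g^*$ is the differential graded algebra of left-invariant forms on $G$ with coefficients in $A^\infty$,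 with $da(X)=\delta_X(a)$ for $a\in A^\infty$, the graded Leibniz rule and $d^2=0$. $\tau_1:\Omega\to\Lambda\mathfrak g^*_{\mathbb C}$ is $\tau_1(a\otimes w)=\tau(a)w$, extended to matrices with the matrix trace. Even Chern-Connes character: for a projection $p\in M_n(A^\infty)$, $Ch_\tau([p]_0)=\Big[\sum_{k\ge0}\frac{1}{(2\pi i)^k k!}\tau_1\big(p(dp\wedge dp)^k\big)\Big]$ in the cohomology of the complex of left-invariant forms of $G$. Odd case: apply the even construction to the system $(A\otimes C(S^1),\,G\times S^1,\,\alpha')$, $\alpha'_{(g,h)}(x\otimes f)=\alpha_g(x)\otimes f_h$, $f_h(t)=f(t-h)$, with trace $\tau\otimes\int_0^{2\pi}d\theta$. For a unitary $u\in M_n(A^\infty)$ let $p_n=\begin{pmatrix}1_n&0\\0&0\end{pmatrix}$ and, for $\theta\in[0,2\pi]$, $p_\theta=w_\theta p_nw_\theta^*$, where $$w_\theta=\begin{pmatrix}u&0\\0&1_n\end{pmatrix}R_\theta\begin{pmatrix}u^*&0\\0&1_n\end{pmatrix}R_\theta^{*},\qquad R_\theta=\begin{pmatrix}\cos(\theta/4)&-\sin(\theta/4)\\ \sin(\theta/4)&\cos(\theta/4)\end{pmatrix}$$ (so $p_0=p_{2\pi}=p_n$). Then $ch_\tau([u]_1)$ is by definition $Ch_\tau([p]_0-[p_n]_0)$, read in $H^*(G)$ through the isomorphism $H^k(G)\oplus H^{k-1}(G)\to H^k(G\times S^1)$, $(a,b)\mapsto \pi_1^*a+\pi_1^*b\wedge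 d\theta$, where $\pi_1:G\times S^1\to G$ is the projection and $d\theta$ is the invariant 1-form dual to the generator $d/dh$ of the $S^1$-action. All cohomology is computed with left-invariant forms. *)

(* Defs.v *)
From HB Require Import structures.
From mathcomp Require Import all_boot all_order all_algebra.
From mathcomp Require Import all_classical all_reals all_analysis.
From mathcomp Require Import complex lra.

Set Implicit Arguments.
Unset Strict Implicit.
Unset Printing Implicit Defensive.

Import Order.TTheory GRing.Theory Num.Theory.
Import numFieldNormedType.Exports.

Local Open Scope classical_set_scope.
Local Open Scope ring_scope.
Local Open Scope complex_scope.

(* Unital C*-algebras. The hierarchy admits no joint structure of ring and
   normed module other than numDomainType, so the norm is a field of the mixin
   and the normed module structure lives on the alias [normed A]. As algebras
   of the library are nonzero, the zero C*-algebra is excluded. *)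
HB.mixin Record isCStarAlgebra (R : realType) A of GRing.Algebra R[i] A := {
  star : A -> A;
  cnorm : A -> R;
  starD : forall a b, star (a + b) = star a + star b;
  starZ : forall (c : R[i]) a, star (c *: a) = (Num.conj c) *: star a;
  starM : forall a b, star (a * b) = star b * star a;
  starK : forall a, star (star a) = a;
  cnormD : forall a b, cnorm (a + b) <= cnorm a + cnorm b;
  cnormZ : forall (c : R[i]) a, (cnorm (c *: a))%:C = `|c| * (cnorm a)%:C;
  cnorm0_eq0 : forall a, cnorm a = 0 -> a = 0;
  cnormM : forall a b, cnorm (a * b) <= cnorm a * cnorm b;
  cnorm_starM : forall a, cnorm (star a * a) = cnorm a ^+ 2;
  cnorm_complete : forall s : nat -> A,
    (forall e : R, 0 < e -> exists N, forall i j, (N <= i)%N -> (N <= j)%N ->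
       cnorm (s i - s j) < e) ->
    exists l, forall e : R, 0 < e -> exists N, forall i, (N <= i)%N ->
       cnorm (s i - l) < e
}.

#[short(type="cstarAlgType")]
HB.structure Definition CStarAlgebra (R : realType) :=
  {A of isCStarAlgebra R A & GRing.Algebra R[i] A}.

Definition normed (R : realType) (A : cstarAlgType R) : Type := A.

Section NormedAlias.
Variables (R : realType) (A : cstarAlgType R).

HB.instance Definition _ := GRing.Lmodule.copy (normed A) A.

Let nrm (a : normed A) : R[i] := (cnorm (a : A))%:C.

Let nrmD x y : nrm (x + y) <= nrm x + nrm y.
Proof. by rewrite /nrm -rmorphD /= lecR cnormD. Qed.

Let nrmZ (c : R[i]) x : nrm (c *: x) = `|c| * nrm x.
Proof. exact: cnormZ. Qed.

Let nrm0 x : nrm x = 0 -> x = 0.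
Proof. by move=> [/cnorm0_eq0]. Qed.

HB.instance Definition _ := Lmodule_isNormed.Build R[i] (normed A) nrmD nrmZ nrm0.

End NormedAlias.

Section Calculus.
Variables (R : realType) (E : normedModType R[i]).

Definition diff_quot (f : R -> E) (t : R) : E := (t^-1)%:C *: (f t - f 0).

Definition has_partial m (f : 'rV[R]_m -> E) (i : 'I_m) (x : 'rV[R]_m) (l : E) :=
  diff_quot (fun t => f (x + t *: delta_mx 0 i)) t @[t --> 0^'] --> l.

Fixpoint class_Ck k m (U : set 'rV[R]_m) (f : 'rV[R]_m -> E) : Prop :=
  (forall x, U x -> {for x, continuous f}) /\
  if k is k'.+1 then
    exists D : 'I_m -> 'rV[R]_m -> E, forall i,
      (forall x, U x -> has_partial f i x (D i x)) /\ class_Ck k' U (D i)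
  else True.

(* only meant for open [U] *)
Definition smooth_on m (U : set 'rV[R]_m) (f : 'rV[R]_m -> E) :=
  forall k, class_Ck k U f.

End Calculus.

#[short(type="topGroupType")]
HB.structure Definition TopologicalGroup := {G of Group G & Topological G}.


Section NormFacts.
Variables (R : realType) (A : cstarAlgType R).
Implicit Types a b : A.

Lemma normedE a : `|a : normed A| = (cnorm a)%:C. Proof. by []. Qed.

Lemma cnorm_ge0 a : 0 <= cnorm a.
Proof. by rewrite -lecR -normedE normr_ge0. Qed.

Lemma cnorm0 : cnorm (0 : A) = 0.
Proof. by apply: (@complexI R); rewrite -normedE normr0. Qed.

Lemma cnormN a : cnorm (- a) = cnorm a.
Proof. by apply: (@complexI R); rewrite -!normedE normrN. Qed.

Lemma cnormB a b : cnorm (a - b) = cnorm (b - a).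
Proof. by rewrite -cnormN opprB. Qed.

Lemma cnorm_triangle b a c : cnorm (a - c) <= cnorm (a - b) + cnorm (b - c).
Proof. by apply: le_trans (cnormD _ _); rewrite subrKA. Qed.

Lemma cnorm_le_star a : cnorm a <= cnorm (star a).
Proof.
have [->|a0] := eqVneq (cnorm a) 0; first exact: cnorm_ge0.
have ap : 0 < cnorm a by rewrite lt_neqAle eq_sym a0 cnorm_ge0.
by rewrite -(ler_pM2r ap) -expr2 -cnorm_starM cnormM.
Qed.

Lemma cnorm_star a : cnorm (star a) = cnorm a.
Proof.
by apply/eqP; rewrite eq_le cnorm_le_star andbT -{2}(starK a) cnorm_le_star.
Qed.

Lemma star0 : star (0 : A) = 0.
Proof. by apply: (addrI (star (0 : A))); rewrite -starD !addr0. Qed.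

Lemma starN a : star (- a) = - star a.
Proof. by apply: (addrI (star a)); rewrite -starD !subrr star0. Qed.

Lemma starB a b : star (a - b) = star a - star b.
Proof. by rewrite starD starN. Qed.

Lemma ncvgP (T : Type) (F : set_system T) (FF : Filter F) (f : T -> A) (l : A) :
  (f : T -> normed A) @ F --> (l : normed A) <->
  (forall e : R, 0 < e -> \forall t \near F, cnorm (f t - l) < e).
Proof.
split=> [/cvgrPdistC_lt H e e0|H].
  have := H e%:C; rewrite ltcR => /(_ e0); apply: filterS => t.
  by rewrite normedE ltcR.
apply/cvgrPdistC_lt => /= -[e e'] /= he.
have /= := he; rewrite ltcE /= => /andP[/eqP e'0 e0]; rewrite {}e'0.
by apply: filterS (H e e0) => t; rewrite normedE ltcR.
Qed.

Lemma ncst_continuous (T : topologicalType) (a : A) :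
  continuous ((fun=> a) : T -> normed A).
Proof. by move=> t; exact: cvg_cst. Qed.

Lemma nadd_continuous (T : topologicalType) (f g : T -> A) :
  continuous (f : T -> normed A) -> continuous (g : T -> normed A) ->
  continuous ((fun t => f t + g t) : T -> normed A).
Proof. by move=> cf cg t; apply: cvgD; [exact: cf|exact: cg]. Qed.

Lemma nopp_continuous (T : topologicalType) (f : T -> A) :
  continuous (f : T -> normed A) ->
  continuous ((fun t => - f t) : T -> normed A).
Proof. by move=> cf t; apply: cvgN; exact: cf. Qed.

Lemma nscale_continuous (T : topologicalType) (c : R[i]) (f : T -> A) :
  continuous (f : T -> normed A) ->
  continuous ((fun t => c *: f t) : T -> normed A).
Proof. by move=> cf t; apply: cvgZr; exact: cf. Qed.

Lemma nstar_continuous (T : topologicalType) (f : T -> A) :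
  continuous (f : T -> normed A) ->
  continuous ((fun t => star (f t)) : T -> normed A).
Proof.
move=> cf t; apply/ncvgP => e e0; have /ncvgP/(_ e e0) := cf t.
by apply: filterS => s; rewrite -starB cnorm_star.
Qed.

Lemma nisometry_continuous (T : topologicalType) (phi : A -> A) (f : T -> A) :
  (forall a b, cnorm (phi a - phi b) = cnorm (a - b)) ->
  continuous (f : T -> normed A) ->
  continuous ((fun t => phi (f t)) : T -> normed A).
Proof.
move=> iso cf t; apply/ncvgP => e e0; have /ncvgP/(_ e e0) := cf t.
by apply: filterS => s; rewrite iso.
Qed.

Lemma cnorm_continuous (T : topologicalType) (f : T -> A) :
  continuous (f : T -> normed A) -> continuous (fun t => cnorm (f t)).
Proof.
move=> cf t; apply/cvgrPdistC_lt => e e0; have /ncvgP/(_ e e0) := cf t.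
apply: filterS => s; apply: le_lt_trans.
have h x y : cnorm x - cnorm y <= cnorm (x - y).
  by rewrite lerBlDr -{1}(subrK y x) cnormD.
by rewrite ler_norml h andbT lerNl opprB cnormB h.
Qed.

Lemma nmul_continuous (T : topologicalType) (f g : T -> A) :
  continuous (f : T -> normed A) -> continuous (g : T -> normed A) ->
  continuous ((fun t => f t * g t) : T -> normed A).
Proof.
move=> cf cg t; apply/ncvgP => e e0.
have fp : 0 < cnorm (f t) + 1 by rewrite ltr_wpDl// cnorm_ge0.
have gp : 0 < cnorm (g t) + 1 by rewrite ltr_wpDl// cnorm_ge0.
have /ncvgP/(_ 1 ltr01) Hf1 := cf t.
have /ncvgP/(_ (e / 2 / (cnorm (g t) + 1))) Hf := cf t.
have /ncvgP/(_ (e / 2 / (cnorm (f t) + 1))) Hg := cg t.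
have {}Hf := Hf (divr_gt0 (divr_gt0 e0 (ltr0n _ 2)) gp).
have {}Hg := Hg (divr_gt0 (divr_gt0 e0 (ltr0n _ 2)) fp).
apply: filterS3 Hf1 Hf Hg => s h1 hf hg.
have -> : f s * g s - f t * g t = f s * (g s - g t) + (f s - f t) * g t.
  by rewrite mulrBr mulrBl addrA subrK.
rewrite (le_lt_trans (cnormD _ _))// [e]splitr ltr_leD//.
  rewrite (le_lt_trans (cnormM _ _))//.
  have : cnorm (f s) <= cnorm (f t) + 1.
    by rewrite -(subrK (f t) (f s)) (le_trans (cnormD _ _))// addrC lerD2l ltW.
  move=> /(ler_wpM2r (cnorm_ge0 (g s - g t))) /le_lt_trans; apply.
  by rewrite mulrC -ltr_pdivlMr.
rewrite (le_trans (cnormM _ _))//.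
rewrite (le_trans (ler_wpM2l (cnorm_ge0 _) (_ : _ <= cnorm (g t) + 1)))//.
  by rewrite lerDl.
by rewrite -ler_pdivlMr// ltW.
Qed.

Lemma nuniform_limit_continuous (T : topologicalType) (l : T -> A) :
  (forall e : R, 0 < e -> exists2 g : T -> A, continuous (g : T -> normed A) &
     forall t, cnorm (g t - l t) <= e) ->
  continuous (l : T -> normed A).
Proof.
move=> H t; apply/ncvgP => e e0; have e30 : 0 < e / 3 by rewrite divr_gt0.
have [g cg gl] := H _ e30; have /ncvgP/(_ _ e30) := cg t.
apply: filterS => s Hs; apply: le_lt_trans (cnorm_triangle (g s) _ _) _.
have -> : e = e / 3 + (e / 3 + e / 3) by lra.
apply: ler_ltD; first by rewrite cnormB gl.
apply: le_lt_trans (cnorm_triangle (g t) _ _) _.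
by apply: ltr_leD => //; exact: gl.
Qed.

End NormFacts.

Section Circle.
Variable R : realType.

Definition circle := {z : R[i] | `|z| == 1}.

HB.instance Definition _ := Choice.on circle.

Definition circle_val (z : circle) : R[i]^o := sval z.

HB.instance Definition _ :=
  Topological.copy circle (initial_topology circle_val).

Lemma circle_val_inj : injective circle_val.
Proof. exact: val_inj. Qed.

Fact circle_one_subproof : `|1 : R[i]| == 1.
Proof. by rewrite normr1. Qed.

Fact circle_mul_subproof (z w : circle) : `|sval z * sval w| == 1.
Proof. by rewrite normrM (eqP (svalP z)) (eqP (svalP w)) mulr1. Qed.

Fact circle_inv_subproof (z : circle) : `|(sval z)^-1| == 1.
Proof. by rewrite normfV (eqP (svalP z)) invr1. Qed.

Definition circle_one : circle := exist _ 1 circle_one_subproof.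
Definition circle_mul (z w : circle) : circle :=
  exist _ (sval z * sval w) (circle_mul_subproof z w).
Definition circle_inv (z : circle) : circle :=
  exist _ (sval z)^-1 (circle_inv_subproof z).

Fact circle_mulA : associative circle_mul.
Proof. by move=> x y z; apply: val_inj; rewrite /= mulrA. Qed.

Fact circle_mul1 : left_id circle_one circle_mul.
Proof. by move=> x; apply: val_inj; rewrite /= mul1r. Qed.

Fact circle_mulr1 : right_id circle_one circle_mul.
Proof. by move=> x; apply: val_inj; rewrite /= mulr1. Qed.

Fact circle_neq0 (z : circle) : sval z != 0.
Proof. by rewrite -normr_eq0 (eqP (svalP z)) oner_eq0. Qed.

Fact circle_mulV : left_inverse circle_one circle_inv circle_mul.
Proof. by move=> x; apply: val_inj; rewrite /= mulVf ?circle_neq0. Qed.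

Fact circle_mulrV : right_inverse circle_one circle_inv circle_mul.
Proof. by move=> x; apply: val_inj; rewrite /= mulfV ?circle_neq0. Qed.

HB.instance Definition _ := isGroup.Build circle
  circle_mulA circle_mul1 circle_mulr1 circle_mulV circle_mulrV.

Fact cis_subproof (t : R) : `|cos t +i* sin t| == 1.
Proof. by rewrite normc_def /= cos2Dsin2 sqrtr1. Qed.

Definition cis (t : R) : circle := exist _ (cos t +i* sin t) (cis_subproof t).

Lemma real_complex_continuous : continuous (fun x : R => x%:C : R[i]^o).
Proof.
move=> x; apply/cvgrPdist_lt => /= -[e e'] /= he.
have /= := he; rewrite ltcE /= => /andP[/eqP e'0 e0]; rewrite {}e'0.
near=> t; rewrite -raddfB normc_def /= expr0n addr0 sqrtr_sqr ltcR.
near: t; exact: cvgr_dist_lt.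
Unshelve. all: by end_near. Qed.

Lemma cis_continuous : continuous (cis).
Proof.
apply: continuous_comp_initial => /= t.
have -> : circle_val \o cis = (fun s => ((cos s)%:C : R[i]^o) + 'i%C *: ((sin s)%:C : R[i]^o)).
  by apply/funext => s /=; rewrite /circle_val/= [LHS]complexE.
apply: cvgD; last apply: cvgZr.
  exact: (continuous_comp (@continuous_cos R t) (@real_complex_continuous _)).
exact: (continuous_comp (@continuous_sin R t) (@real_complex_continuous _)).
Qed.

Lemma cis_surj (z : circle) : exists2 t, 0 <= t <= 2 * pi & cis t = z.
Proof.
case: z => -[a b] /= h; have : a ^+ 2 + b ^+ 2 = 1.
  move/eqP: (h); rewrite normc_def /= => -[] /(congr1 (fun x => x ^+ 2)).
  by rewrite sqr_sqrtr ?expr1n// addr_ge0 ?sqr_ge0.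
move=> ab.
have a1 : -1 <= a <= 1.
  by rewrite -ler_norml -(@expr_le1 _ 2) ?normr_ge0// real_normK ?num_real// -ab lerDl sqr_ge0.
have [/andP[t0 tpi] ct] := acos_def a1.
have st := sin_acos a1.
have sqb : Num.sqrt (1 - a ^+ 2) = `|b| by rewrite -ab addrC addKr sqrtr_sqr.
have [b0|b0] := leP 0 b.
  exists (acos a).
    by rewrite t0/= (le_trans tpi)// ler_peMl ?pi_ge0// ler1n.
  by apply: circle_val_inj; rewrite /= ct st sqb ger0_norm.
exists (2 * pi - acos a).
  by rewrite lerBlDr lerDl t0 andbT subr_ge0 (le_trans tpi)// ler_peMl ?pi_ge0// ler1n.
apply: circle_val_inj => /=.
have E : 2 * pi - acos a = - acos a + pi *+ 2 :> R by rewrite addrC mulr_natl.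
by rewrite E cosD2pi sinD2pi cosN sinN ct st sqb ltr0_norm// opprK.
Qed.

Lemma circle_compact : compact [set: circle].
Proof.
rewrite (_ : setT = cis @` `[0, 2 * pi]).
  apply: continuous_compact; last exact: segment_compact.
  by apply: continuous_subspaceT; exact: cis_continuous.
by apply/esym/seteqP; split => // z _; have [t ht <-] := cis_surj z; exists t => //=; rewrite in_itv.
Qed.

Lemma circle_val_continuous : continuous circle_val.
Proof. exact: (@initial_continuous _ _ circle_val). Qed.

Lemma circle_mulr_continuous (w : circle) :
  continuous (fun z : circle => (z * w)%g).
Proof.
apply: continuous_comp_initial => z.
have -> : circle_val \o (fun z : circle => (z * w)%g) =
   (fun z => circle_val w *: circle_val z).
  by apply/funext => x; rewrite /= /circle_val /= mulrC.
exact: (continuous_comp (@circle_val_continuous z) (@scaler_continuous _ _ _ _)).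
Qed.

End Circle.

(* C(S^1, A), which is A (x) C(S^1) *)
Record loops (R : realType) (A : cstarAlgType R) := Loop {
  loop_fun :> circle R -> A;
  loop_continuous : continuous (loop_fun : circle R -> normed A)
}.

Section LoopAlgebra.
Variables (R : realType) (A : cstarAlgType R).
Local Notation B := (loops A).
Implicit Types f g h : B.

HB.instance Definition _ := gen_eqMixin B.
HB.instance Definition _ := gen_choiceMixin B.

Lemma loopP f g : (forall z, f z = g z) -> f = g.
Proof.
case: f g => [f cf] [g cg] /= /funext fg; subst g.
by rewrite (Prop_irrelevance cf cg).
Qed.

Fact loop_cst_subproof (a : A) : continuous ((fun=> a) : circle R -> normed A).
Proof. exact: ncst_continuous. Qed.

Fact loop_add_subproof f g :
  continuous ((fun z => f z + g z) : circle R -> normed A).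
Proof. by apply: nadd_continuous; exact: loop_continuous. Qed.

Fact loop_opp_subproof f : continuous ((fun z => - f z) : circle R -> normed A).
Proof. by apply: nopp_continuous; exact: loop_continuous. Qed.

Fact loop_scale_subproof (c : R[i]) f :
  continuous ((fun z => c *: f z) : circle R -> normed A).
Proof. by apply: nscale_continuous; exact: loop_continuous. Qed.

Definition loop_cst a : B := Loop (@loop_cst_subproof a).
Definition loop_add f g : B := Loop (@loop_add_subproof f g).
Definition loop_opp f : B := Loop (@loop_opp_subproof f).
Definition loop_scale c f : B := Loop (@loop_scale_subproof c f).
Definition loop_mul f g : B :=
  Loop (@nmul_continuous _ _ _ _ _ (@loop_continuous _ _ f) (@loop_continuous _ _ g)).
Definition loop_star f : B := Loop (@nstar_continuous _ _ _ _ (@loop_continuous _ _ f)).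

Fact loop_addA : associative loop_add.
Proof. by move=> f g h; apply: loopP => z /=; rewrite addrA. Qed.
Fact loop_addC : commutative loop_add.
Proof. by move=> f g; apply: loopP => z /=; rewrite addrC. Qed.
Fact loop_add0 : left_id (loop_cst 0) loop_add.
Proof. by move=> f; apply: loopP => z /=; rewrite add0r. Qed.
Fact loop_addN : left_inverse (loop_cst 0) loop_opp loop_add.
Proof. by move=> f; apply: loopP => z /=; rewrite addNr. Qed.

HB.instance Definition _ :=
  GRing.isZmodule.Build B loop_addA loop_addC loop_add0 loop_addN.

Fact loop_mulA : associative loop_mul.
Proof. by move=> f g h; apply: loopP => z /=; rewrite mulrA. Qed.
Fact loop_mul1 : left_id (loop_cst 1) loop_mul.
Proof. by move=> f; apply: loopP => z /=; rewrite mul1r. Qed.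
Fact loop_mulr1 : right_id (loop_cst 1) loop_mul.
Proof. by move=> f; apply: loopP => z /=; rewrite mulr1. Qed.
Fact loop_mulDl : left_distributive loop_mul loop_add.
Proof. by move=> f g h; apply: loopP => z /=; rewrite mulrDl. Qed.
Fact loop_mulDr : right_distributive loop_mul loop_add.
Proof. by move=> f g h; apply: loopP => z /=; rewrite mulrDr. Qed.
Fact loop_1neq0 : loop_cst 1 != loop_cst 0.
Proof.
apply/eqP => /(congr1 (fun f : B => f (circle_one R))) /= /eqP.
by rewrite oner_eq0.
Qed.

HB.instance Definition _ := GRing.Zmodule_isNzRing.Build B
  loop_mulA loop_mul1 loop_mulr1 loop_mulDl loop_mulDr loop_1neq0.

Fact loop_scaleA c d f : loop_scale c (loop_scale d f) = loop_scale (c * d) f.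
Proof. by apply: loopP => z /=; rewrite scalerA. Qed.
Fact loop_scale1 : left_id 1 loop_scale.
Proof. by move=> f; apply: loopP => z /=; rewrite scale1r. Qed.
Fact loop_scaleDr : right_distributive loop_scale +%R.
Proof. by move=> c f g; apply: loopP => z /=; rewrite scalerDr. Qed.
Fact loop_scaleDl f : {morph loop_scale^~ f : c d / c + d}.
Proof. by move=> c d; apply: loopP => z /=; rewrite scalerDl. Qed.

HB.instance Definition _ := GRing.Zmodule_isLmodule.Build R[i] B
  loop_scaleA loop_scale1 loop_scaleDr loop_scaleDl.

Fact loop_scaleAl (c : R[i]) f g : c *: (f * g) = (c *: f) * g.
Proof. by apply: loopP => z /=; rewrite scalerAl. Qed.

HB.instance Definition _ := GRing.Lmodule_isLalgebra.Build R[i] B loop_scaleAl.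

Fact loop_scaleAr (c : R[i]) f g : c *: (f * g) = f * (c *: g).
Proof. by apply: loopP => z /=; rewrite scalerAr. Qed.

HB.instance Definition _ := GRing.Lalgebra_isAlgebra.Build R[i] B loop_scaleAr.

Definition loop_norm f : R := sup [set cnorm (f z) | z in [set: circle R]].

Lemma loop_norm_has_sup f : has_sup [set cnorm (f z) | z in [set: circle R]].
Proof.
split; first by exists (cnorm (f (circle_one R))), (circle_one R).
have : compact [set cnorm (f z) | z in [set: circle R]].
  apply: continuous_compact; last exact: circle_compact.
  by apply: continuous_subspaceT; exact: cnorm_continuous (@loop_continuous _ _ f).
move=> /compact_bounded[M [Mr HM]].
exists (M + 1); apply/ubP => _ [z _ <-].
by apply: le_trans (ler_norm _) _; apply: (HM (M + 1)); [rewrite ltrDl|exists z].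
Qed.

Lemma loop_norm_ub f z : cnorm (f z) <= loop_norm f.
Proof. by apply: ub_le_sup; [case: (loop_norm_has_sup f)|exists z]. Qed.

Lemma loop_norm_le f M : (forall z, cnorm (f z) <= M) -> loop_norm f <= M.
Proof.
move=> fM; apply: ge_sup; first by case: (loop_norm_has_sup f).
by apply/ubP => _ [z _ <-].
Qed.

Lemma loop_norm_ge0 f : 0 <= loop_norm f.
Proof. exact: le_trans (cnorm_ge0 _) (loop_norm_ub f (circle_one R)). Qed.

Fact loop_starD f g : loop_star (f + g) = loop_star f + loop_star g.
Proof. by apply: loopP => z /=; rewrite starD. Qed.
Fact loop_starZ (c : R[i]) f :
  loop_star (c *: f) = (Num.conj c) *: loop_star f.
Proof. by apply: loopP => z /=; rewrite starZ. Qed.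
Fact loop_starM f g : loop_star (f * g) = loop_star g * loop_star f.
Proof. by apply: loopP => z /=; rewrite starM. Qed.
Fact loop_starK f : loop_star (loop_star f) = f.
Proof. by apply: loopP => z /=; rewrite starK. Qed.

Fact loop_normD f g : loop_norm (f + g) <= loop_norm f + loop_norm g.
Proof.
apply: loop_norm_le => z; apply: le_trans (cnormD _ _) _.
by apply: lerD; exact: loop_norm_ub.
Qed.

Fact loop_normZ (c : R[i]) f :
  (loop_norm (c *: f))%:C = `|c| * (loop_norm f)%:C.
Proof.
have [r r0 cr] : exists2 r : R, 0 <= r & `|c| = r%:C.
  have hc := RRe_real (normr_real c).
  by exists (complex.Re `|c|); rewrite ?hc// -lecR hc normr_ge0.
have nZ z : cnorm (c *: f z) = r * cnorm (f z).
  by apply: (@complexI R); rewrite cnormZ cr rmorphM.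
rewrite cr -rmorphM /=; congr (_%:C); apply/eqP; rewrite eq_le; apply/andP; split.
  by apply: loop_norm_le => z /=; rewrite nZ ler_wpM2l// loop_norm_ub.
have [->|rn0] := eqVneq r 0; first by rewrite mul0r loop_norm_ge0.
have rp : 0 < r by rewrite lt_neqAle eq_sym rn0.
rewrite mulrC -ler_pdivlMr//; apply: loop_norm_le => z.
by rewrite ler_pdivlMr// mulrC -nZ (loop_norm_ub (c *: f)).
Qed.

Fact loop_norm0_eq0 f : loop_norm f = 0 -> f = 0.
Proof.
move=> f0; apply: loopP => z /=; apply: cnorm0_eq0; apply/eqP.
by rewrite eq_le cnorm_ge0 andbT -f0 loop_norm_ub.
Qed.

Fact loop_normM f g : loop_norm (f * g) <= loop_norm f * loop_norm g.
Proof.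
apply: loop_norm_le => z; apply: le_trans (cnormM _ _) _.
by apply: ler_pM; rewrite ?cnorm_ge0// loop_norm_ub.
Qed.

Fact loop_norm_starM f : loop_norm (loop_star f * f) = loop_norm f ^+ 2.
Proof.
apply/eqP; rewrite eq_le; apply/andP; split.
  apply: loop_norm_le => z /=; rewrite cnorm_starM.
  by rewrite lerXn2r ?nnegrE ?cnorm_ge0 ?loop_norm_ge0 ?loop_norm_ub.
rewrite -[leRHS]sqr_sqrtr ?loop_norm_ge0//.
rewrite lerXn2r ?nnegrE ?sqrtr_ge0 ?loop_norm_ge0//.
apply: loop_norm_le => z; rewrite -(@ger0_norm _ (cnorm _)) ?cnorm_ge0//.
by rewrite -sqrtr_sqr ler_wsqrtr// -cnorm_starM (loop_norm_ub (loop_star f * f)).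
Qed.

Fact loop_complete (s : nat -> B) :
  (forall e : R, 0 < e -> exists N, forall i j, (N <= i)%N -> (N <= j)%N ->
     loop_norm (s i - s j) < e) ->
  exists l, forall e : R, 0 < e -> exists N, forall i, (N <= i)%N ->
     loop_norm (s i - l) < e.
Proof.
move=> cs.
have pw z : exists l : A, forall e : R, 0 < e -> exists N, forall i,
    (N <= i)%N -> cnorm (s i z - l) < e.
  apply: cnorm_complete => e /cs[N HN]; exists N => i j Ni Nj.
  by apply: le_lt_trans (HN i j Ni Nj); exact: (loop_norm_ub (s i - s j)).
have [l Hl] := choice pw.
have unif e : 0 < e -> exists N, forall i, (N <= i)%N -> forall z,
    cnorm (s i z - l z) <= e.
  move=> /[dup] e0 /cs[N HN]; exists N => i Ni z; apply/ler_addgt0Pr => d d0.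
  have [M HM] := Hl z d d0.
  apply: le_trans (cnorm_triangle (s (maxn N M) z) _ _) _; apply: lerD.
    apply: le_trans (loop_norm_ub (s i - s (maxn N M)) z) _.
    by rewrite ltW// HN// leq_maxl.
  by rewrite ltW// HM// leq_maxr.
have cl : continuous (l : circle R -> normed A).
  apply: nuniform_limit_continuous => e /unif[N HN].
  by exists (s N) => [|z]; [exact: loop_continuous|exact: HN].
exists (Loop cl) => e e0; have e20 : 0 < e / 2 by rewrite divr_gt0.
have [N HN] := unif _ e20; exists N => i Ni.
apply: (@le_lt_trans _ _ (e / 2)); last by rewrite ltr_pdivrMr// ltr_pMr// ltr1n.
by apply: loop_norm_le => z; exact: HN.
Qed.

HB.instance Definition _ := isCStarAlgebra.Build R B
  loop_starD loop_starZ loop_starM loop_starK loop_normD loop_normZ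
  loop_norm0_eq0 loop_normM loop_norm_starM loop_complete.

End LoopAlgebra.

HB.instance Definition _ (G H : topGroupType) := Topological.on (G * H)%type.

(* A group with a family of local parametrizations (inverses of charts): the
   pair [(V, psi)] stands for the restriction of [psi] to the open set [V].
   The axioms are in [is_lie_group]. *)
Record lieData (R : realType) (m : nat) := LieData {
  lie_car :> topGroupType;
  lie_param : set (set 'rV[R]_m * ('rV[R]_m -> lie_car))
}.

Arguments lie_param {R m} l _.

Section LieGroups.
Variables (R : realType) (m : nat) (G : lieData R m).

Definition coord (c : set 'rV[R]_m * ('rV[R]_m -> G)) (g : G) : 'rV[R]_m :=
  xget 0 [set x | c.1 x /\ c.2 x = g].

Definition smooth_into k (U : set 'rV[R]_k) (F : 'rV[R]_k -> G) :=
  (forall x, U x -> {for x, continuous F}) /\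
  forall c, lie_param G c -> forall j,
    smooth_on (U `&` F @^-1` (c.2 @` c.1))
              (fun x => (coord c (F x) 0 j)%:C : R[i]^o).

(* second countability is not required *)
Record is_lie_group : Prop := {
  lie_hausdorff : hausdorff_space G;
  lie_cover : forall g : G, exists c x, [/\ lie_param G c, c.1 x & c.2 x = g];
  lie_chart : forall c, lie_param G c ->
    [/\ open c.1,
        forall x y, c.1 x -> c.1 y -> c.2 x = c.2 y -> x = y,
        forall x, c.1 x -> {for x, continuous c.2} &
        forall U, U `<=` c.1 -> open U -> open (c.2 @` U)];
  lie_transition : forall c, lie_param G c -> smooth_into c.1 c.2;
  lie_mul_smooth : forall c c', lie_param G c -> lie_param G c' ->
    smooth_into [set x : 'rV_(m + m) | c.1 (lsubmx x) /\ c'.1 (rsubmx x)]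
                (fun x => (c.2 (lsubmx x) * c'.2 (rsubmx x))%g);
  lie_inv_smooth : forall c, lie_param G c ->
    smooth_into c.1 (fun x => (c.2 x)^-1%g)
}.

Definition smooth_fun (E : normedModType R[i]) (F : G -> E) :=
  forall c, lie_param G c -> smooth_on c.1 (fun x => F (c.2 x)).

(* [X] in the Lie algebra is represented by [t |-> exp (t X)] *)
Definition one_parameter_subgroup (X : R -> G) :=
  (forall s t, X (s + t) = (X s * X t)%g) /\
  smooth_into [set: 'rV[R]_1] (fun t => X (t 0 0)).

(* the initial velocities, read in a chart at 1, are linearly independent *)
Definition is_lie_basis (X : 'I_m -> R -> G) :=
  (forall i, one_parameter_subgroup (X i)) /\
  forall c, lie_param G c -> (c.2 @` c.1) 1%g ->
    \matrix_(i < m, j < m) derive1 (fun t => coord c (X i t) 0 j) 0 \in unitmx.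

(* left-invariant vector field *)
Definition invariant_field (X : R -> G) (f : G -> R[i]^o) (g : G) : R[i]^o :=
  lim (diff_quot (fun t => f (g * X t)%g) t @[t --> 0^']).

(* [X_i, X_j] = \sum_k c (i, j, k) X_k *)
Definition structure_constants (X : 'I_m -> R -> G)
    : {ffun 'I_m * 'I_m * 'I_m -> R} :=
  xget 0 [set c : {ffun 'I_m * 'I_m * 'I_m -> R} |
    forall f : G -> R[i]^o, smooth_fun f -> forall i j g,
      invariant_field (X i) (invariant_field (X j) f) g -
      invariant_field (X j) (invariant_field (X i) f) g =
      \sum_k (c (i, j, k))%:C * invariant_field (X k) f g].

End LieGroups.

Definition lie_prod (R : realType) m k (G : lieData R m) (H : lieData R k)
    : lieData R (m + k) :=
  @LieData R (m + k) (G * H)%type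
    [set c | exists c1 c2, [/\ lie_param G c1, lie_param H c2 &
      c = ([set x : 'rV_(m + k) | c1.1 (lsubmx x) /\ c2.1 (rsubmx x)],
           fun x => (c1.2 (lsubmx x), c2.2 (rsubmx x)))]].

Definition lie_circle (R : realType) : lieData R 1 :=
  @LieData R 1 (circle R)
    [set c | exists a, c = ([set x : 'rV[R]_1 | a - pi < x 0 0 < a + pi],
                            fun x : 'rV[R]_1 => cis (x 0 0))].

(* basis of the Lie algebra of G x S^1: that of G, followed by d/dh *)
Definition susp_basis (R : realType) m (G : lieData R m) (X : 'I_m -> R -> G)
    (i : 'I_(m + 1)) (t : R) : lie_prod G (lie_circle R) :=
  match fintype.split i with
  | inl j => (X j t, 1%g)
  | inr _ => (1%g, cis t)
  end.

Section Forms.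
Variable m : nat.

(* Forms with coefficients in [V] on an m-dimensional Lie algebra: [w S] is the
   coefficient of e^{i_1} /\ ... /\ e^{i_k}, S = {i_1 < ... < i_k}, for the
   basis e dual to the chosen one. *)
Definition form (V : Type) := {ffun {set 'I_m} -> V}.

Definition form0 (V : zmodType) (a : V) : form V :=
  [ffun S : {set 'I_m} => if S == finset.set0 then a else 0].

(* e^S /\ e^T = (-1)^{inversions} e^(S u T) *)
Definition inversions (S T : {set 'I_m}) :=
  #|[set ij : 'I_m * 'I_m | [&& ij.1 \in S, ij.2 \in T & (ij.2 < ij.1)%N]]%SET|.

Definition wedge (K : pzRingType) (w w' : form K) : form K :=
  [ffun S : {set 'I_m} => \sum_(T : {set 'I_m} | T \subset S)
     (-1) ^+ inversions T (S :\: T)%SET * (w T * w' (S :\: T)%SET)].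

Definition dual_basis (K : pzRingType) (S : {set 'I_m}) : form K :=
  [ffun T : {set 'I_m} => (T == S)%:R].

Definition even_part (V : zmodType) (w : form V) : form V :=
  [ffun S : {set 'I_m} => if odd #|S| then 0 else w S].

Definition odd_part (V : zmodType) (w : form V) : form V :=
  [ffun S : {set 'I_m} => if odd #|S| then w S else 0].

End Forms.

(* Chevalley-Eilenberg differential of complex left-invariant forms:
   the derivation with d e^k = - \sum_(i < j) c (i, j, k) e^i /\ e^j *)
Definition ce_diff (R : realType) m (c : {ffun 'I_m * 'I_m * 'I_m -> R})
    (w : form m R[i]) : form m R[i] :=
  \sum_(S : {set 'I_m}) \sum_(k in S)
    wedge (form0 m (w S * (-1) ^+ inversions [set k]%SET (S :\ k)%SET))
      (wedge (\sum_(i : 'I_m) \sum_(j : 'I_m | (i < j)%N)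
                wedge (form0 m (- (c (i, j, k))%:C)) (dual_basis _ [set i; j]%SET))
             (dual_basis _ (S :\ k)%SET)).

Definition cohomologous (R : realType) m (G : lieData R m)
    (X : 'I_m -> R -> G) (w w' : form m R[i]) :=
  exists eta, w - w' = ce_diff (structure_constants X) eta.

(* pull-back under the projection G x S^1 -> G *)
Definition pull (R : realType) m (w : form m R[i]) : form (m + 1) R[i] :=
  [ffun T : {set 'I_(m + 1)} => \sum_(S : {set 'I_m} | [set lshift 1 i | i in S]%SET == T) w S].

Definition dtheta (R : realType) m : form (m + 1) R[i] :=
  dual_basis _ [set rshift m ord0]%SET.

(* Norm preservation is automatic for *-automorphisms of a C*-algebra. *)
Record cstar_action (R : realType) m (G : lieData R m) (A : cstarAlgType R) := {
  action :> G -> A -> A;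
  actionD : forall g a b, action g (a + b) = action g a + action g b;
  actionZ : forall g (c : R[i]) a, action g (c *: a) = c *: action g a;
  actionM : forall g a b, action g (a * b) = action g a * action g b;
  action_unit : forall g, action g 1 = 1;
  action_star : forall g a, action g (star a) = star (action g a);
  action_norm : forall g a, cnorm (action g a) = cnorm a;
  action1 : forall a, action 1%g a = a;
  action_mul : forall g h a, action (g * h)%g a = action g (action h a);
  action_continuous : forall a, continuous ((fun g => action g a) : G -> normed A)
}.

Section ChernConnes.
Variables (R : realType) (m : nat) (G : lieData R m) (A : cstarAlgType R).
Variables (alpha : G -> A -> A) (tau : A -> R[i]) (X : 'I_m -> R -> G).

Definition smooth_elt (a : A) := smooth_fun (fun g => alpha g a : normed A).

Definition smooth_mx k l (M : 'M[A]_(k, l)) := forall i j, smooth_elt (M i j).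

Definition derivation (Y : R -> G) (a : A) : A :=
  lim (diff_quot (fun t => alpha (Y t) a : normed A) t @[t --> 0^']).

Record is_trace : Prop := {
  traceD : forall a b, tau (a + b) = tau a + tau b;
  traceZ : forall (c : R[i]) a, tau (c *: a) = c * tau a;
  trace_continuous : continuous (tau : normed A -> R[i]^o);
  trace_pos : forall a, 0 <= tau (star a * a);
  traceC : forall a b, tau (a * b) = tau (b * a);
  trace_invariant : forall g a, tau (alpha g a) = tau a
}.

Definition adjmx k l (M : 'M[A]_(k, l)) : 'M[A]_(l, k) := (map_mx star M)^T.

Definition unitary k (u : 'M[A]_k) :=
  u *m adjmx u = 1%:M /\ adjmx u *m u = 1%:M.

Definition projection k (p : 'M[A]_k) := p *m p = p /\ adjmx p = p.

Definition mvn_equiv k l (p : 'M[A]_k) (q : 'M[A]_l) :=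
  exists v : 'M[A]_(l, k), adjmx v *m v = p /\ v *m adjmx v = q.

Definition dsum k l (p : 'M[A]_k) (q : 'M[A]_l) : 'M[A]_(k + l) :=
  block_mx p 0 0 q.

(* [p] - [q] = [p'] - [q'] in K_0(A), for projections p, q, p', q' *)
Definition K0_eq k l k' l' (p : 'M[A]_k) (q : 'M[A]_l)
    (p' : 'M[A]_k') (q' : 'M[A]_l') :=
  exists j (r : 'M[A]_j), projection r /\
    mvn_equiv (dsum (dsum p q') r) (dsum (dsum p' q) r).

(* dp, with dp(X) = delta_X(p) *)
Definition diff_mx k (p : 'M[A]_k) : form m 'M[A]_k :=
  [ffun S : {set 'I_m} => \sum_(i | S == [set i]%SET) map_mx (derivation (X i)) p].

(* The sum over j is finite since (dp /\ dp)^j = 0 for 2 j > m. *)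
Definition chern_form k (p : 'M[A]_k) : form m R[i] :=
  let dp := diff_mx p in
  [ffun S : {set 'I_m} => \sum_(j < m.+1) ((2 * pi%:C * 'i%C) ^+ j * (j`!)%:R)^-1 *
     tau (\tr (wedge (form0 m p)
                 (iter j (wedge (wedge dp dp)) (form0 m 1%:M)) S))].

(* [w] represents Ch_tau([p] - [q]), for projections p, q over A: as K_0 of the
   smooth subalgebra is K_0(A), the value is that of the defining formula on
   projections over the smooth subalgebra with the same class. *)
Definition is_chern k l (p : 'M[A]_k) (q : 'M[A]_l) (w : form m R[i]) :=
  exists k' l' (p' : 'M[A]_k') (q' : 'M[A]_l'),
    [/\ projection p' /\ smooth_mx p', projection q' /\ smooth_mx q',
        K0_eq p q p' q' &
        cohomologous X (chern_form p' - chern_form q') w].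

End ChernConnes.

Section Suspension.
Variables (R : realType) (m : nat) (G : lieData R m) (A : cstarAlgType R).
Variables (alpha : cstar_action G A) (tau : A -> R[i]) (X : 'I_m -> R -> G).

Fact susp_action_subproof (gh : lie_prod G (lie_circle R)) (f : loops A) :
  continuous ((fun z => alpha gh.1 (f (z * gh.2^-1)%g)) : circle R -> normed A).
Proof.
have cf : continuous ((fun z => f (z * gh.2^-1)%g) : circle R -> normed A).
  move=> z; exact: (continuous_comp (@circle_mulr_continuous _ _ z)
                      (@loop_continuous _ _ f _)).
apply: nisometry_continuous cf => a b.
by rewrite -scaleN1r -actionZ -actionD scaleN1r action_norm.
Qed.

(* x (x) f |-> alpha_g(x) (x) f_h with f_h(t) = f(t - h), the circle being
   written multiplicatively *)
Definition susp_action (gh : lie_prod G (lie_circle R)) (f : loops A)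
    : loops A := Loop (@susp_action_subproof gh f).

Definition susp_trace (f : loops A) : R[i] :=
  (\int[lebesgue_measure]_(t in `[0, 2 * pi]) complex.Re (tau (f (cis t))))%:C +
  'i%C *
  (\int[lebesgue_measure]_(t in `[0, 2 * pi]) complex.Im (tau (f (cis t))))%:C.

Definition rotation n (t : R) : 'M[A]_(n + n) :=
  block_mx (cos (t / 4))%:C%:A%:M (- (sin (t / 4))%:C%:A)%:M
           (sin (t / 4))%:C%:A%:M (cos (t / 4))%:C%:A%:M.

Definition clutching n (u : 'M[A]_n) (t : R) : 'M[A]_(n + n) :=
  dsum u 1%:M *m rotation n t *m dsum (adjmx u) 1%:M *m adjmx (rotation n t).

Definition clutching_projection n (u : 'M[A]_n) (t : R) : 'M[A]_(n + n) :=
  clutching u t *m dsum 1%:M 0 *m adjmx (clutching u t).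

(* [w] represents ch_tau([u]_1). In the isomorphism (a, b) |-> a + b /\ dtheta,
   a and b have even and odd degrees since Ch has even degree. *)
Definition is_chern_odd n (u : 'M[A]_n) (w : form m R[i]) :=
  exists p : 'M[loops A]_(n + n),
    (forall t, 0 <= t <= 2 * pi ->
       map_mx (fun f : loops A => f (cis t)) p = clutching_projection u t) /\
    is_chern susp_action susp_trace (susp_basis X)
      p (dsum 1%:M 0 : 'M[loops A]_(n + n))
      (pull (even_part w) + wedge (pull (odd_part w)) (dtheta R m)).

End Suspension.

(* Main.v *)
Require Import Defs.
From HB Require Import structures.
From mathcomp Require Import all_boot all_order all_algebra.
From mathcomp Require Import all_classical all_reals all_analysis.
From mathcomp Require Import complex ring lra.

Import Order.TTheory GRing.Theory Num.Theory.
Import numFieldNormedType.Exports.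

Local Open Scope classical_set_scope.
Local Open Scope ring_scope.
Local Open Scope complex_scope.

Set Implicit Arguments.
Unset Strict Implicit.
Unset Printing Implicit Defensive.

(** The system suspended by the circle is two-dimensional, so the Chern form of a
smooth projection [p] over it has a degree 0 part, the integrated trace of [p],
and a degree 2 part, 1 / (2 pi i) times the integral over the circle of
tau tr (p [D_X p, D_h p]), where D_X comes from [X] and D_h = - d/dtheta from the
rotations of the circle.

Write the clutching projection as p_theta = V V^*, where V is the isometry formed
by the first column of w_theta. With c = cos (theta / 4) and s = sin (theta / 4),
V has the blocks c^2 + s^2 u and c s (u^* - 1) ([clutching_column]). For any
family of isometries, the curvature density of V V^* reduces modulo commutators to
tau tr (D_X V^* D_h V - D_h V^* D_X V) ([projection_curvature]). For this V, as
tau vanishes on derivatives of orbits and D_X (u^* u) = 0, it is the derivative of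
s^4 - c^2 s^2 times tau (u^* D_X u) ([trace_column_deriv], [chern_density]).
The function s^4 - c^2 s^2 goes from 0 to 1, hence the integral is
tau (u^* D_X u) ([susp_trace_curvature]). The degree 0 part is cancelled by that
of the constant projection ([susp_trace_rank]).

The loop p_theta is continuous but in general not smooth at theta = 0, where its
one-sided derivatives need not agree. The formula is therefore applied to
theta |-> p_(rho theta), where rho is a smooth function equal to 0 before 0 and to
2 pi after 2 pi, hence flat at both ends ([slowed]). This loop is the sum of a
constant projection and of multiples of three matrices over the smooth subalgebra
by scalar functions that are flat at the base point
([smooth_clutching_loop_entry]), which gives its smoothness and the existence of
its derivatives. Both loops have the same class in
K_0, since V_(rho theta) V_theta^* is a continuous loop of partial isometries from
one to the other ([clutching_loop_mvn]).

The derivative of a smooth element along the one-parameter group exists by the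
chain rule in a chart at the unit ([smooth_elt_deriv]). *)

(** * Derivatives of curves in a C*-algebra *)

Section CurveCalculus.
Variables (R : realType) (A : cstarAlgType R).
Implicit Types (a b l : A) (f g : R -> A).

(** Partial derivatives, derivatives in time and derivations are all derivatives at 0
of suitable curves. *)
Definition curve_deriv f l :=
  diff_quot (f : R -> normed A) t @[t --> 0^'] --> (l : normed A).

Lemma ncvgM (T : Type) (F : set_system T) (FF : Filter F) (f g : T -> A) a b :
  (f : T -> normed A) @ F --> (a : normed A) ->
  (g : T -> normed A) @ F --> (b : normed A) ->
  ((fun t => f t * g t) : T -> normed A) @ F --> (a * b : normed A).
Proof.
move=> /ncvgP Hf /ncvgP Hg; apply/ncvgP => e e0.
have ap : 0 < cnorm a + 1 by rewrite ltr_wpDl// cnorm_ge0.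
have bp : 0 < cnorm b + 1 by rewrite ltr_wpDl// cnorm_ge0.
have {}Hg1 := Hg _ ltr01.
have {}Hf := Hf _ (divr_gt0 (divr_gt0 e0 (ltr0n _ 2)) bp).
have {}Hg := Hg _ (divr_gt0 (divr_gt0 e0 (ltr0n _ 2)) ap).
apply: filterS3 Hg1 Hf Hg => s h1 hf hg.
have -> : f s * g s - a * b = (f s - a) * g s + a * (g s - b).
  by rewrite mulrBr mulrBl addrA subrK.
rewrite (le_lt_trans (cnormD _ _))// [e]splitr ltr_leD//.
  rewrite (le_lt_trans (cnormM _ _))//.
  have : cnorm (g s) <= cnorm b + 1.
    by rewrite -(subrK b (g s)) (le_trans (cnormD _ _))// addrC lerD2l ltW.
  move=> /(ler_wpM2l (cnorm_ge0 (f s - a))) /le_lt_trans; apply.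
  by rewrite -ltr_pdivlMr.
rewrite (le_trans (cnormM _ _))//.
rewrite (le_trans (ler_wpM2r (cnorm_ge0 _) (_ : _ <= cnorm a + 1)))//.
  by rewrite lerDl.
by rewrite mulrC -ler_pdivlMr// ltW.
Qed.

Lemma ncvg_star (T : Type) (F : set_system T) (FF : Filter F) (f : T -> A) a :
  (f : T -> normed A) @ F --> (a : normed A) ->
  ((fun t => star (f t)) : T -> normed A) @ F --> (star a : normed A).
Proof.
move=> /ncvgP Hf; apply/ncvgP => e /Hf; apply: filterS => t.
by rewrite -starB cnorm_star.
Qed.

Lemma curve_deriv_unique f l l' : curve_deriv f l -> curve_deriv f l' -> l = l'.
Proof. exact: (@cvg_unique _ (@norm_hausdorff _ (normed A))). Qed.

Lemma curve_deriv_lim f l : curve_deriv f l ->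
  lim (diff_quot (f : R -> normed A) t @[t --> 0^']) = l :> A.
Proof. exact: (@cvg_lim (normed A) (@norm_hausdorff _ (normed A))). Qed.

Lemma curve_deriv_cst a : curve_deriv (fun=> a) 0.
Proof.
rewrite /curve_deriv /diff_quot; under eq_fun do rewrite subrr scaler0.
exact: cvg_cst.
Qed.

Lemma curve_deriv_near f g l : f 0 = g 0 -> (\forall t \near 0^', f t = g t) ->
  curve_deriv f l -> curve_deriv g l.
Proof.
move=> fg0 fg; apply: cvg_trans; apply: near_eq_cvg.
by apply: filterS fg => t fgt; rewrite /diff_quot fg0 fgt.
Qed.

Lemma normc_real (x : R) : `|x%:C : R[i]| = `|x|%:C.
Proof. by rewrite normc_def /= expr0n addr0 sqrtr_sqr. Qed.

Lemma real_complex_cvg0 : (t%:C : R[i]^o) @[t --> (0:R)^'] --> (0 : R[i]^o).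
Proof.
apply: cvg_within_filter.
exact: (@real_complex_continuous R 0).
Qed.

(** The increment is [t] times the difference quotient. *)
Lemma curve_deriv_cvg f l : curve_deriv f l ->
  (f : R -> normed A) @ 0^' --> (f 0 : normed A).
Proof.
move=> fl.
have : (f 0 + t%:C *: diff_quot (f : R -> normed A) t : normed A) @[t --> 0^']
   --> (f 0 + 0 *: l : normed A).
  by apply: cvgD; [exact: cvg_cst|exact: (cvgZ real_complex_cvg0)].
rewrite scale0r addr0; apply: cvg_trans; apply: near_eq_cvg.
have : \forall t \near (0:R)^', t != 0 by exact: nbhs_dnbhs_neq.
apply: filterS => t t0.
by rewrite /diff_quot scalerA -rmorphM mulfV// scale1r subrKC.
Qed.

(** The derivation rules below are limits of algebraic identities between
difference quotients; here [q] is the right-hand side of such an identity. *)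
Lemma curve_deriv_from (q : R -> A) f l :
  (q : R -> normed A) @ 0^' --> (l : normed A) ->
  (forall t, q t = (t^-1)%:C *: (f t - f 0)) -> curve_deriv f l.
Proof. by move=> ql /funext qE; rewrite /curve_deriv /diff_quot -qE. Qed.

Lemma curve_derivD f g l l' : curve_deriv f l -> curve_deriv g l' ->
  curve_deriv (fun t => f t + g t) (l + l').
Proof.
move=> fl gl; apply: (curve_deriv_from (cvgD fl gl)) => t /=.
by rewrite !fctE /diff_quot -scalerDr opprD addrACA.
Qed.

Lemma curve_deriv_sum (I : Type) (r : seq I) (F : I -> R -> A) (L : I -> A) :
  (forall i, curve_deriv (F i) (L i)) ->
  curve_deriv (fun t => \sum_(i <- r) F i t) (\sum_(i <- r) L i).
Proof.
move=> FL; elim: r => [|i r IH].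
  by under eq_fun do rewrite big_nil; rewrite big_nil; exact: curve_deriv_cst.
by under eq_fun do rewrite big_cons; rewrite big_cons; exact: curve_derivD.
Qed.

Lemma curve_derivM f g l l' : curve_deriv f l -> curve_deriv g l' ->
  curve_deriv (fun t => f t * g t) (l * g 0 + f 0 * l').
Proof.
move=> fl gl; have fgl := ncvgM _ fl (curve_deriv_cvg gl).
have f0l := ncvgM _ (cvg_cst (f 0 : normed A)) gl.
apply: (curve_deriv_from (cvgD (fgl _) (f0l _ _))) => t /=.
by rewrite !fctE /diff_quot -scalerAl -scalerAr -scalerDr mulrBr mulrBl addrA subrK.
Qed.

Lemma curve_derivZ (c : R[i]) f l : curve_deriv f l ->
  curve_deriv (fun t => c *: f t) (c *: l).
Proof.
move=> fl; apply: (curve_deriv_from (cvgZr (k := c) fl)) => t /=.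
by rewrite scalerA mulrC -scalerA scalerBr.
Qed.

Lemma curve_deriv_star f l : curve_deriv f l ->
  curve_deriv (fun t => star (f t)) (star l).
Proof.
move=> fl; apply: (curve_deriv_from (ncvg_star _ fl)) => t /=.
by rewrite /diff_quot starZ starB conj_Creal// complex_real.
Qed.

Lemma curve_deriv_real (phi : R -> R) (x d : R) a : is_derive x 1 phi d ->
  curve_deriv (fun t => (phi (x + t))%:C *: a) (d%:C *: a).
Proof.
move=> [/cvg_ex[d' dd'] dE]; have {dE} d'E : d' = d by rewrite -dE; apply/esym/cvg_lim.
rewrite {}d'E in dd'; apply/ncvgP => e e0.
have ap : 0 < cnorm a + 1 by rewrite ltr_wpDl// cnorm_ge0.
have /cvgrPdistC_lt /(_ _ (divr_gt0 e0 ap)) := dd'.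
apply: filterS => t /=; rewrite /GRing.scale/= mulr1 (addrC t) => H.
rewrite /diff_quot addr0 -scalerBl scalerA -scalerBl.
suff -> : cnorm (((t^-1)%:C * ((phi (x + t))%:C - (phi x)%:C) - d%:C) *: a) =
   `|t^-1 * (phi (x + t) - phi x) - d| * cnorm a.
  apply: (@le_lt_trans _ _ (`|t^-1 * (phi (x + t) - phi x) - d| * (cnorm a + 1))).
    by rewrite ler_wpM2l// lerDl.
  by rewrite -ltr_pdivlMr.
have -> : (t^-1)%:C * ((phi (x + t))%:C - (phi x)%:C) - d%:C =
    (t^-1 * (phi (x + t) - phi x) - d)%:C by rewrite rmorphB rmorphM rmorphB.
apply: (@complexI R); rewrite cnormZ [RHS]rmorphM; congr (_ * _).
exact: normc_real.
Qed.

End CurveCalculus.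

(** * Smooth functions of several variables and smooth elements *)

Section SmoothFunctions.
Variables (R : realType) (A : cstarAlgType R) (m : nat).
Implicit Types (U : set 'rV[R]_m) (f g : 'rV[R]_m -> A) (k : nat).

Lemma class_Ck_cst k U (a : A) : class_Ck k U ((fun=> a) : 'rV[R]_m -> normed A).
Proof.
elim: k a => [|k IH] a /=; split=> //.
- by move=> x _; exact: ncst_continuous.
- by move=> x _; exact: ncst_continuous.
exists (fun _ _ => 0) => i; split=> [x _|]; last exact: IH.
exact: curve_deriv_cst.
Qed.

Lemma class_Ck_pred k U (f : 'rV[R]_m -> normed A) :
  class_Ck k.+1 U f -> class_Ck k U f.
Proof.
elim: k f => [|k IH] f [cf [D Df]]; split=> //.
by exists D => i; have [pf /IH] := Df i.
Qed.

Lemma class_CkD k U f g : class_Ck k U (f : _ -> normed A) ->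
  class_Ck k U (g : _ -> normed A) ->
  class_Ck k U ((fun x => f x + g x) : _ -> normed A).
Proof.
elim: k f g => [|k IH] f g [cf Df] [cg Dg]; split=> //.
- by move=> x Ux; exact: (@cvgD _ (normed A) _ _ _ f g _ _ (cf x Ux) (cg x Ux)).
- by move=> x Ux; exact: (@cvgD _ (normed A) _ _ _ f g _ _ (cf x Ux) (cg x Ux)).
case: Df => D Df; case: Dg => D' Dg.
exists (fun i x => D i x + D' i x) => i.
have [pf Ckf] := Df i; have [pg Ckg] := Dg i; split; last exact: IH.
by move=> x Ux; apply: curve_derivD; [exact: pf|exact: pg].
Qed.

(** The partial derivatives of a product are sums of products of functions of
class C^k, so the induction must vary both factors. *)
Lemma class_CkM k U f g : class_Ck k U (f : _ -> normed A) ->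
  class_Ck k U (g : _ -> normed A) ->
  class_Ck k U ((fun x => f x * g x) : _ -> normed A).
Proof.
elim: k f g => [|k IH] f g; move=> /[dup] [] [cf Df] Hf /[dup] [] [cg Dg] Hg; split=> //.
- by move=> x Ux; exact: (ncvgM _ (cf x Ux) (cg x Ux)).
- by move=> x Ux; exact: (ncvgM _ (cf x Ux) (cg x Ux)).
case: Df => D Df; case: Dg => D' Dg.
exists (fun i x => (D i x : A) * g x + f x * D' i x) => i.
have [pf Ckf] := Df i; have [pg Ckg] := Dg i; split.
  move=> x Ux; have := curve_derivM (pf x Ux) (pg x Ux).
  by rewrite !scale0r !addr0.
by apply: class_CkD; apply: IH => //; exact: class_Ck_pred.
Qed.

Lemma class_Ck_star k U f : class_Ck k U (f : _ -> normed A) ->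
  class_Ck k U ((fun x => star (f x)) : _ -> normed A).
Proof.
elim: k f => [|k IH] f [cf Df]; split=> //.
- by move=> x Ux; exact: (ncvg_star _ (cf x Ux)).
- by move=> x Ux; exact: (ncvg_star _ (cf x Ux)).
case: Df => D Df; exists (fun i x => star (D i x : A)) => i.
have [pf Ckf] := Df i; split; last exact: IH.
by move=> x Ux; apply: curve_deriv_star; exact: pf.
Qed.

End SmoothFunctions.

Section SmoothElements.
Variables (R : realType) (m : nat) (G : lieData R m) (A : cstarAlgType R).
Variable alpha : G -> A -> A.

Lemma smooth_eltD a b : (forall g, alpha g (a + b) = alpha g a + alpha g b) ->
  smooth_elt alpha a -> smooth_elt alpha b -> smooth_elt alpha (a + b).
Proof.
move=> aD sa sb c hc k; have := class_CkD (sa c hc k) (sb c hc k).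
by under [X in class_Ck _ _ X -> _]eq_fun do rewrite -aD.
Qed.

Lemma smooth_eltM a b : (forall g, alpha g (a * b) = alpha g a * alpha g b) ->
  smooth_elt alpha a -> smooth_elt alpha b -> smooth_elt alpha (a * b).
Proof.
move=> aM sa sb c hc k; have := class_CkM (sa c hc k) (sb c hc k).
by under [X in class_Ck _ _ X -> _]eq_fun do rewrite -aM.
Qed.

Lemma smooth_elt_star a : (forall g, alpha g (star a) = star (alpha g a)) ->
  smooth_elt alpha a -> smooth_elt alpha (star a).
Proof.
move=> aS sa c hc k; have := class_Ck_star (sa c hc k).
by under [X in class_Ck _ _ X -> _]eq_fun do rewrite -aS.
Qed.

Lemma smooth_elt_fixed a : (forall g, alpha g a = a) -> smooth_elt alpha a.
Proof.
move=> afix c hc k; have := @class_Ck_cst R A m k c.1 a.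
by congr class_Ck; apply/funext => x; rewrite afix.
Qed.

End SmoothElements.

(** * Derivatives along a one-parameter subgroup *)

Section OrbitDerivative.
Variables (R : realType) (A : cstarAlgType R).

Lemma real_complex_cvg_inv (T : Type) (F : set_system T) (FF : Filter F)
    (f : T -> R) (g : T -> R[i]^o) :
  (g : T -> R[i]^o) @ F --> (0 : R[i]^o) ->
  (\forall t \near F, g t = (f t)%:C) ->
  f @ F --> (0 : R).
Proof.
move=> /cvgrPdistC_lt H fg; apply/cvgrPdistC_lt => e e0.
have /H : 0 < e%:C by rewrite ltcR.
by apply: filterS2 fg => t ->; rewrite !subr0 normc_real ltcR.
Qed.

(** Chain rule for an inner function [r] that may return to 0 arbitrarily close to
0: the difference quotient of [f] is extended by its limit [l], so that
f (r t) - f 0 = r t *: q (r t) holds for all t. *)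
Lemma curve_deriv_chain (f : R -> A) (l : A) (r : R -> R) (d : R[i]) :
  curve_deriv f l -> r 0 = 0 ->
  (((t^-1 * r t)%:C : R[i]^o) @[t --> (0:R)^'] --> (d : R[i]^o)) ->
  curve_deriv (fun t => f (r t)) (d *: l).
Proof.
move=> fl r0 rd.
pose q s : A := if s == 0 then l else diff_quot (f : R -> normed A) s.
have q0 : (q : R -> normed A) s @[s --> (0:R)] --> (l : normed A).
  apply/ncvgP => e e0.
  have /ncvgP/(_ e e0) := fl; rewrite near_withinE; apply: filterS => s Hs.
  rewrite /q; case: eqP => [_|/eqP/Hs//].
  by rewrite subrr cnorm0.
have rcvg : r t @[t --> (0:R)^'] --> (0 : R).
  have H0 : (t%:C *: ((t^-1 * r t)%:C : R[i]^o) : R[i]^o) @[t --> (0:R)^']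
      --> (0 *: (d : R[i]^o) : R[i]^o).
    exact: (cvgZ (@real_complex_cvg0 R) rd).
  rewrite scale0r in H0.
  apply: (real_complex_cvg_inv _ H0).
  have : \forall t \near (0:R)^', t != 0 by exact: nbhs_dnbhs_neq.
  apply: filterS => t t0.
  by rewrite /GRing.scale /= -rmorphM mulrA mulfV// mul1r.
have qr : (q (r t) : normed A) @[t --> (0:R)^'] --> (l : normed A).
  exact: (cvg_comp _ _ rcvg q0).
apply: (curve_deriv_from (cvgZ rd qr)) => t /=.
rewrite r0 /q; case: eqP => [->|/eqP rt0].
  by rewrite mulr0 scale0r subrr scaler0.
rewrite /diff_quot scalerA -rmorphM -mulrA mulfV//.
by rewrite mulr1.
Qed.

Variables (G : lieData R 1) (hG : is_lie_group G) (X : R -> G).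
Hypothesis hX : one_parameter_subgroup X.
Variable alpha : G -> A -> A.

Lemma one_parameter_subgroup0 : X 0 = 1%g.
Proof. by case: hX => XD _; apply: (@mulgI _ (X 0)); rewrite -XD addr0 mulg1. Qed.

(** In a chart at the unit the orbit map is a C^1 function of one variable, and
the one-parameter subgroup is a C^1 curve of coordinates; the derivative is that of
their composite. *)
Lemma smooth_elt_deriv a : smooth_elt alpha a ->
  curve_deriv (fun t => alpha (X t) a) (derivation alpha X a).
Proof.
move=> sa; suff [l fl] : exists l, curve_deriv (fun t => alpha (X t) a) l.
  by rewrite /derivation (curve_deriv_lim fl).
have [c [x0 [hc cx0 c1]]] := lie_cover hG 1%g.
have [co cinj ccont cop] := lie_chart hG hc.
have coordK x : c.1 x -> Defs.coord c (c.2 x) = x.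
  move=> cx; rewrite /Defs.coord; case: xgetP => [y _ [cy cyx]|/(_ x)]; first exact: cinj.
  by case.
have [_ [D /(_ ord0)[pD _]]] := sa c hc 1%N.
case: hX => XD [Xc /(_ c hc ord0 1%N)[_ [E /(_ ord0)[pE _]]]].
have X0 := one_parameter_subgroup0.
(* pE bears on the coordinates of X at time 0, pD on the orbit map at x0. *)
have {pE}/pE : ([set: 'rV[R]_1] `&` (fun t : 'rV[R]_1 => X (t 0 0)) @^-1` (c.2 @` c.1)) 0.
  by split=> //; exists x0 => //=; rewrite mxE X0.
have := pD x0 cx0.
rewrite /has_partial => Fl rl.
pose r t := Defs.coord c (X t) 0 0 - x0 0 0.
have cX0 : Defs.coord c (X 0) = x0 by rewrite X0 -c1 coordK.
have r0 : r 0 = 0 by rewrite /r cX0 subrr.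
have rd : ((t^-1 * r t)%:C : R[i]^o) @[t --> (0:R)^'] --> (E ord0 0 : R[i]^o).
  apply: cvg_trans rl; apply: near_eq_cvg; apply: nearW => t.
  rewrite /diff_quot !scale0r !add0r !mxE /= mulr1 cX0.
  by rewrite rmorphM rmorphB.
have := curve_deriv_chain Fl r0 rd; set l := _ *: _ => fl; exists l.
apply: curve_deriv_near fl; first by rewrite r0 scale0r addr0 c1 X0.
have near1 : \forall t \near (0:R)^', (c.2 @` c.1) (X t).
  have nb : nbhs ((fun t : 'rV[R]_1 => X (t 0 0)) 0) (c.2 @` c.1).
    by rewrite mxE X0; apply: open_nbhs_nbhs; split; [exact: cop|exists x0].
  have Z0 : (t *: (delta_mx 0 0 : 'rV[R]_1)) @[t --> (0:R)^'] --> (0 : 'rV[R]_1).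
    rewrite -(scale0r (delta_mx 0 0 : 'rV[R]_1)).
    by apply: cvgZl; apply: cvg_within.
  have : \forall t \near (0:R)^',
      (c.2 @` c.1) (X ((t *: (delta_mx 0 0 : 'rV[R]_1)) 0 0)).
    exact: (Z0 _ (Xc 0 I _ nb)).
  by apply: filterS => t; rewrite !mxE mulr1.
apply: filterS near1 => t [x cx xt].
congr (alpha _ a); rewrite -xt; congr (c.2 _).
by apply/rowP => i; rewrite (ord1 i) !mxE mulr1 /r -xt coordK// subrKC.
Qed.

End OrbitDerivative.

(** * Loops as functions on [0, 2 pi] *)

Section CircleGluing.
Variable R : realType.
Implicit Types (s t : R) (z : circle R).

Lemma cisD s t : cis (s + t) = (cis s * cis t)%g.
Proof.
apply: circle_val_inj; rewrite /circle_val /= cosD sinD; apply/eqP.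
by rewrite eq_complex /= eqxx addrC (mulrC (sin s)) (addrC (cos s * _)) eqxx.
Qed.

Lemma cis0 : cis 0 = 1%g :> circle R.
Proof. by apply: circle_val_inj; rewrite /circle_val /= cos0 sin0. Qed.

Lemma cis_2pi : cis (2 * pi) = 1%g :> circle R.
Proof.
by apply: circle_val_inj; rewrite /circle_val /= mulr_natl cos2pi sin2pi.
Qed.

Lemma cisV t : (cis t)^-1%g = cis (- t).
Proof. by apply: (@mulgI _ (cis t)); rewrite mulgV -cisD subrr cis0. Qed.

Lemma cis_inj s t :
  0 <= s < 2 * pi -> 0 <= t < 2 * pi -> cis s = cis t -> s = t.
Proof.
wlog ts : s t / t <= s.
  move=> H hs ht e; have [le|/ltW le] := leP t s; first exact: H.
  by apply/esym/H.
move=> /andP[s0 s2] /andP[t0 t2] e; apply/eqP; rewrite -subr_eq0; apply/eqP.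
have c1 : cos (s - t) = 1.
  have := congr1 (fun z => complex.Re (circle_val (z * (cis t)^-1)%g)) e.
  by rewrite mulgV cisV -cisD /= => ->.
have [//|st0] := eqVneq (s - t) 0.
have st : 0 < s - t by rewrite lt_neqAle eq_sym st0 subr_ge0.
have : 0 < sin ((s - t) / 2).
  by apply: sin_gt0_pi; rewrite divr_gt0// ltr_pdivrMr// mulrC; lra.
move=> sin0; suff : sin ((s - t) / 2) = 0 by move=> s0'; rewrite s0' ltxx in sin0.
apply/eqP; rewrite -sqrf_eq0; have := cos2Dsin2 ((s - t) / 2).
by move: c1; rewrite [in cos (s - t)](splitr (s - t)) cosD; nra.
Qed.

Lemma circle_hausdorff : hausdorff_space (circle R).
Proof.
move=> p q pq; apply: (@circle_val_inj R).
apply: (@norm_hausdorff _ (R[i]^o)) => U V nU nV.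
have [r [rU rV]] := pq _ _ (circle_val_continuous nU) (circle_val_continuous nV).
by exists (circle_val r).
Qed.

(** The circle is a quotient of [0, 2 pi]: a preimage of a closed set is the image
under [cis] of a compact set. *)
Lemma circle_quotient (T : topologicalType) (f : R -> T) (g : circle R -> T) :
  continuous f -> (forall t, 0 <= t <= 2 * pi -> g (cis t) = f t) ->
  continuous g.
Proof.
move=> cf gf; apply/continuous_closedP => C cC.
have -> : g @^-1` C = @cis R @` (`[0, 2 * pi] `&` f @^-1` C).
  apply/seteqP; split=> [z Cz|_ [t [t02 Ct] <-]].
    have [t t02 tz] := cis_surj z; exists t => //; split; first by rewrite /= in_itv.
    by rewrite /= -gf// tz.
  by rewrite /= gf//; rewrite /= in_itv in t02.
apply: compact_closed; first exact: circle_hausdorff.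
apply: continuous_compact.
  by apply: continuous_subspaceT; exact: cis_continuous.
apply: (@subclosed_compact _ _ `[0, 2 * pi]).
- apply: closedI; first exact: itv_closed.
  by move/continuous_closedP : cf; apply.
- exact: segment_compact.
- exact: subIsetl.
Qed.

Variable A : cstarAlgType R.

(** Arbitrary unless [f] is continuous with equal values at 0 and 2 pi; a total
function spares the proofs of these facts as arguments. *)
Definition glue (f : R -> A) : loops A :=
  xget 0 [set g : loops A | forall t, 0 <= t <= 2 * pi -> g (cis t) = f t].

Lemma glueE (f : R -> A) t : continuous (f : R -> normed A) ->
  f 0 = f (2 * pi) -> 0 <= t <= 2 * pi -> glue f (cis t) = f t.
Proof.
move=> cf f02; move: t.
suff [g gf] : exists g : loops A, forall t, 0 <= t <= 2 * pi -> g (cis t) = f t.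
  by rewrite /glue; case: xgetP => [h _ //|/(_ g)].
have [arg argP] := choice (fun z : circle R => (let: ex_intro2 t t02 tz := cis_surj z in
  ex_intro _ t (conj t02 tz) : exists t, 0 <= t <= 2 * pi /\ cis t = z)).
have red t : 0 <= t <= 2 * pi ->
    exists2 t1, 0 <= t1 < 2 * pi & cis t1 = cis t /\ f t1 = f t.
  move=> /andP[t0 t2]; have [tlt|tge] := ltP t (2 * pi); first by exists t; rewrite ?t0.
  have -> : t = 2 * pi by apply/le_anti/andP.
  by exists 0; rewrite ?lexx ?mulr_gt0 ?pi_gt0// cis_2pi cis0.
pose g z : A := f (arg z).
have gf t' : 0 <= t' <= 2 * pi -> g (cis t') = f t'.
  move=> /red[t1 t1lt [ct <-]]; have [/red[s1 s1lt [cs fs]] cs'] := argP (cis t').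
  by rewrite /g -fs; congr f; apply: cis_inj => //; rewrite cs cs' ct.
by exists (Loop (circle_quotient (T := normed A) cf gf)).
Qed.

Lemma loop_eqP (f g : loops A) :
  (forall t, 0 <= t < 2 * pi -> f (cis t) = g (cis t)) -> f = g.
Proof.
move=> fg; apply: loopP => z; have [t /andP[t0 t2] <-] := cis_surj z.
have [tlt|tge] := ltP t (2 * pi); first by rewrite fg// t0.
have -> : t = 2 * pi by apply/le_anti/andP.
by rewrite cis_2pi -cis0 fg// lexx mulr_gt0// pi_gt0.
Qed.

End CircleGluing.

(** * Smooth real functions and a flat step *)

Section SmoothRealFunctions.
Variable R : realType.
Implicit Types (f g : R -> R) (k : nat).

Fixpoint real_Ck k f : Prop :=
  if k is k'.+1 then
    exists2 f' : R -> R, (forall x : R, is_derive x 1 f (f' x)) & real_Ck k' f'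
  else True.

Definition real_smooth f := forall k, real_Ck k f.

Lemma real_Ck_pred k f : real_Ck k.+1 f -> real_Ck k f.
Proof. by elim: k f => [//|k IH] f [f' df /IH]; exists f'. Qed.

Lemma real_Ck_cst k (c : R) : real_Ck k (fun=> c).
Proof.
elim: k c => [//|k IH] c; exists (fun=> 0) => //.
by move=> x; exact: is_derive_cst.
Qed.

Lemma real_CkD k f g : real_Ck k f -> real_Ck k g -> real_Ck k (fun x => f x + g x).
Proof.
elim: k f g => [//|k IH] f g [f' df Cf] [g' dg Cg].
by exists (fun x => f' x + g' x); [move=> x; exact: is_deriveD|exact: IH].
Qed.

Lemma real_CkM k f g : real_Ck k f -> real_Ck k g -> real_Ck k (fun x => f x * g x).
Proof.
elim: k f g => [//|k IH] f g Hf Hg.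
case: (Hf) => f' df Cf; case: (Hg) => g' dg Cg.
exists (fun x => f x * g' x + g x * f' x); first by move=> x; exact: is_deriveM.
by apply: real_CkD; apply: IH => //; exact: real_Ck_pred.
Qed.

Lemma real_CkV k f : (forall x, f x != 0) -> real_Ck k f ->
  real_Ck k (fun x => (f x)^-1).
Proof.
move=> f0; elim: k => [//|k IH] /[dup] /real_Ck_pred /IH Vf [f' df Cf].
exists (fun x => -1 * ((f x)^-1 * (f x)^-1) * f' x); last first.
  by do !apply: real_CkM => //; exact: real_Ck_cst.
by move=> x; apply: is_derive_eq (is_deriveV (f0 x) (df x)) _; rewrite mulN1r -exprVn expr2.
Qed.

Lemma real_smooth_deriv f : real_smooth f ->
  exists2 f' : R -> R, (forall x : R, is_derive x 1 f (f' x)) & real_smooth f'.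
Proof.
move=> sf; have [f' df _] := sf 1%N; exists f' => // k.
have [f1 df1 Ck1] := sf k.+1; suff -> : f' = f1 by [].
apply/funext => x.
by rewrite -(@derive_val _ _ _ _ _ _ _ (df x)) (@derive_val _ _ _ _ _ _ _ (df1 x)).
Qed.

Lemma real_Ck_comp k f g : real_smooth f -> real_smooth g ->
  real_Ck k (fun x => f (g x)).
Proof.
elim: k f g => [//|k IH] f g sf sg.
have [f' df sf'] := real_smooth_deriv sf; have [g' dg sg'] := real_smooth_deriv sg.
exists (fun x => f' (g x) * g' x); first by move=> x; exact: is_derive1_comp.
by apply: real_CkM; [exact: IH|exact: sg'].
Qed.

Lemma real_smooth_continuous f : real_smooth f -> continuous f.
Proof.
move=> /real_smooth_deriv[f' df _] x; apply/differentiable_continuous/derivable1_diffP.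
by case: (df x).
Qed.

Lemma real_Ck_sin_cos k : real_Ck k (@sin R) /\ real_Ck k (@cos R).
Proof.
elim: k => [//|k [IHs IHc]]; split.
  by exists (@cos R) => // x; exact: is_derive_sin.
exists (fun x => -1 * sin x); last by apply: real_CkM => //; exact: real_Ck_cst.
by move=> x; rewrite mulN1r; exact: is_derive_cos.
Qed.

(** For [k = 0] the classical function exp (-1/x), flat at 0. The powers of 1/x are
included because the family is stable under differentiation. *)
Definition flat k (x : R) : R := if 0 < x then x^-1 ^+ k * expR (- x^-1) else 0.

(** From t^(k+1) / (k+1)! <= exp t at t = 1/x. *)
Lemma flat_le k (x : R) : `|flat k x| <= (k.+1)`!%:R * `|x|.
Proof.
rewrite /flat; case: ifP => x0; last by rewrite normr0 mulr_ge0.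
have i0 : 0 < x^-1 by rewrite invr_gt0.
rewrite (gtr0_norm x0) ger0_norm; last by rewrite mulr_ge0// ?expR_ge0// exprn_ge0// ltW.
have := expR_ge1Dxn k (ltW i0).
rewrite expRN ler_pdivrMr ?expR_gt0// => H.
rewrite -mulrA mulrCA -ler_pdivrMl// mulrC -ler_pdivrMl ?ltr0n ?fact_gt0//.
rewrite -exprSr mulrC; apply: le_trans H.
by rewrite lerDr.
Qed.

(** At 0 the difference quotient of [flat k] is [flat k.+1], which tends to 0 by
[flat_le]. *)
Lemma is_derive_flat k (x : R) :
  is_derive x 1 (flat k) (flat k.+2 x - k%:R * flat k.+1 x).
Proof.
have [x0|x0|<-] := ltgtP 0 x.
- apply: (@near_eq_is_derive _ _ _ ((fun x : R => x^-1) ^+ k * (expR \o (fun x : R => - x^-1)))).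
    by apply: filterS (lt_nbhsr x0) => y y0; rewrite !fctE /= /flat y0.
  have dV : is_derive x 1 (fun x : R => x^-1) (- x ^- 2).
    by rewrite -[- _]mulr1; apply: (@is_deriveV R id) => //; rewrite gt_eqF.
  have dN : is_derive x 1 (fun x : R => - x^-1) (- - x ^- 2) := is_deriveN dV.
  have dE := @is_derive1_comp R expR (fun x => - x^-1) x _ _ (is_derive_expR _) dN.
  apply: is_derive_eq (is_deriveM (is_deriveX k dV) dE) _.
  rewrite /flat x0 /GRing.scale /= !fctE opprK -exprVn.
  by case: k => [|k]; rewrite ?exprS /=; ring.
- apply: (@near_eq_is_derive _ _ _ (fun=> 0)).
    by apply: filterS (lt_nbhsl x0) => y y0; rewrite /flat ltNge (ltW y0).
  apply: is_derive_eq (is_derive_cst _ _ _) _.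
  by rewrite /flat ltNge (ltW x0) /= mulr0 subr0.
- have fl0 j : flat j 0 = 0 by rewrite /flat ltxx.
  rewrite !fl0 mulr0 subr0.
  have H : h^-1 *: ((flat k \o shift 0) (h *: 1) - flat k 0) @[h --> 0^'] --> (0:R).
    apply/cvgr0Pnorm_lt => e e0.
    have c0 : 0 < (k.+2)`!%:R + 1 :> R by rewrite ltr_wpDl.
    have := nbhs_dnbhs_neq (0 : R).
    have : \forall h \near (0:R)^', `|h| < e / ((k.+2)`!%:R + 1).
      by apply: dnbhs0_lt; rewrite divr_gt0.
    apply: filterS2 => h he h0; rewrite fl0 subr0 /= addr0 /GRing.scale /= mulr1.
    have -> : h^-1 * flat k h = flat k.+1 h.
      by rewrite /flat; case: ifP; rewrite ?mulr0// exprS mulrA.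
    apply: le_lt_trans (flat_le _ _) _.
    apply: (@le_lt_trans _ _ (((k.+2)`!%:R + 1) * `|h|)); last first.
      by rewrite mulrC -ltr_pdivlMr.
    by rewrite ler_wpM2r// lerDl.
  by split; [apply/cvg_ex; exists 0|apply: cvg_lim H].
Qed.

Lemma real_smooth_flat k : real_smooth (flat k).
Proof.
move=> j; elim: j k => [//|j IH] k.
exists (fun x => flat k.+2 x + - k%:R * flat k.+1 x).
  by move=> x; rewrite mulNr; exact: is_derive_flat.
by apply: real_CkD => //; apply: real_CkM => //; exact: real_Ck_cst.
Qed.

(** A smooth step from 0 to 1 across [0, 2 pi]; the two terms of the denominator do
not vanish together. *)
Definition step (t : R) : R :=
  flat 0 t / (flat 0 t + flat 0 (2 * pi - t)).

Lemma flat_ge0 k (x : R) : 0 <= flat k x.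
Proof.
rewrite /flat; case: ifP => // x0.
by rewrite mulr_ge0 ?expR_ge0// exprn_ge0// invr_ge0 ltW.
Qed.

Lemma flat0_gt0 (x : R) : 0 < x -> 0 < flat 0 x.
Proof. by rewrite /flat => ->; rewrite mul1r expR_gt0. Qed.

Lemma flat_le0 k (x : R) : x <= 0 -> flat k x = 0.
Proof. by rewrite /flat ltNge => ->. Qed.

Lemma step_denom_neq0 t : flat 0 t + flat 0 (2 * pi - t) != 0.
Proof.
apply: lt0r_neq0; have := flat_ge0 0 t; have := flat_ge0 0 (2 * pi - t).
have [t0|/flat0_gt0] := leP t 0; last by lra.
have /flat0_gt0 : 0 < 2 * pi - t by have := pi_gt0 R; lra.
by lra.
Qed.

Lemma real_smooth_step : real_smooth step.
Proof.
have sr k : real_Ck k (fun t : R => flat 0 (2 * pi - t)).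
  apply: real_Ck_comp; first exact: real_smooth_flat.
  move=> [//|j]; exists (fun=> -1); last exact: real_Ck_cst.
  move=> x; apply: is_derive_eq (is_deriveB (is_derive_cst _ _ _) (is_derive_id _ _)) _.
  by rewrite sub0r.
move=> k; apply: real_CkM; first exact: real_smooth_flat.
apply: real_CkV; first exact: step_denom_neq0.
by apply: real_CkD => //; exact: real_smooth_flat.
Qed.

Lemma step_le0 t : t <= 0 -> step t = 0.
Proof. by move=> t0; rewrite /step flat_le0 ?mul0r. Qed.

Lemma step_ge2pi t : 2 * pi <= t -> step t = 1.
Proof.
move=> t0; have := step_denom_neq0 t.
by rewrite /step (@flat_le0 0 (2 * pi - t)) ?addr0 ?subr_le0// => ?; rewrite divff.
Qed.

End SmoothRealFunctions.
(** * Rotations of loops with scalar values *)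

Section StarUnit.
Variables (R : realType) (A : cstarAlgType R).

Lemma star1 : star (1 : A) = 1.
Proof. by rewrite -[LHS]mul1r -[X in X * _]starK -starM mul1r starK. Qed.

Lemma cnorm1 : cnorm (1 : A) = 1.
Proof.
have := cnorm_starM (1 : A); rewrite star1 mulr1 expr2 => e.
have n0 : cnorm (1 : A) != 0.
  by apply/eqP => /cnorm0_eq0 /eqP; rewrite oner_eq0.
by apply: (mulfI n0); rewrite -e mulr1.
Qed.

End StarUnit.

Section SmoothLoops.
Variables (R : realType) (A : cstarAlgType R).
Implicit Types (phi : R -> R) (L : loops A).

Fact rot_subproof (y : R) L :
  continuous ((fun z => L (z * (cis y)^-1)%g) : circle R -> normed A).
Proof.
move=> z; exact: (continuous_comp (@circle_mulr_continuous _ _ z)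
                    (@loop_continuous _ _ L _)).
Qed.

Definition rot (y : R) L : loops A := Loop (@rot_subproof y L).

Lemma rotD x y L : rot (x + y) L = rot x (rot y L).
Proof. by apply: loopP => z /=; rewrite !cisV -mulgA -cisD opprD. Qed.

Lemma rot0 L : rot 0 L = L.
Proof. by apply: loopP => z /=; rewrite cis0 invg1 mulg1. Qed.

Lemma rot_norm y L : cnorm (rot y L) = cnorm L.
Proof.
have le y' L' : cnorm (rot y' L') <= cnorm L'.
  by apply: loop_norm_le => z; exact: (loop_norm_ub L').
by apply/eqP; rewrite eq_le le -{1}[L]rot0 -(addNr y) rotD le.
Qed.

(** Differentiability of a loop at the parameter 0 of the rotation group suffices,
since rotations form a group of isometries. *)
Fixpoint rot_Ck k L : Prop :=
  if k is k'.+1 then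
    exists2 L', curve_deriv (fun t => rot t L) L' & rot_Ck k' L'
  else True.

Definition supported phi := forall t, t <= 0 \/ 2 * pi <= t -> phi t = 0.

Definition scalar_loop phi : loops A := glue (fun t => (phi t)%:C *: (1 : A)).

Lemma real_scale_continuous phi (a : A) : continuous phi ->
  continuous ((fun t => (phi t)%:C *: a) : R -> normed A).
Proof.
move=> cphi t; have c1 := continuous_comp (cphi t) (@real_complex_continuous R (phi t)).
exact: (cvgZ c1 (cvg_cst (a : normed A))).
Qed.

(** The periodization of [phi] on three periods; at most one of the three terms is
nonzero. *)
Lemma scalar_loopE phi t : continuous phi -> supported phi -> - (2 * pi) <= t <= 4 * pi ->
  scalar_loop phi (cis t) =
  (phi t)%:C *: 1 + (phi (t + 2 * pi))%:C *: 1 + (phi (t - 2 * pi))%:C *: 1.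
Proof.
move=> cphi sphi /andP[t1 t2]; have pi0 := pi_gt0 R.
have ph0 : phi 0 = 0 by apply: sphi; left.
have ph2 : phi (2 * pi) = 0 by apply: sphi; right.
have cs := @real_scale_continuous phi 1 cphi.
have gl s : 0 <= s <= 2 * pi -> scalar_loop phi (cis s) = (phi s)%:C *: 1.
  by move=> s02; rewrite /scalar_loop glueE// ph0 ph2.
have [t0|t0] := leP t 0.
  rewrite (sphi t) ?(sphi (t - 2 * pi)); [|by left; lra|by left].
  rewrite !scale0r add0r addr0 -gl; last by apply/andP; split; lra.
  by rewrite cisD cis_2pi mulg1.
have [t3|t3] := leP t (2 * pi).
  rewrite (sphi (t + _)) ?(sphi (t - 2 * pi)); [|by left; lra|by right; lra].
  by rewrite !scale0r !addr0 -gl//; apply/andP; split; lra.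
rewrite (sphi (t + _)) ?(sphi t); [|by right; lra|by right; lra].
rewrite !scale0r !add0r -gl; last by apply/andP; split; lra.
by rewrite cisD -cisV cis_2pi invg1 mulg1.
Qed.

Lemma mean_value (f f' : R -> R) a b : (forall x : R, is_derive x 1 f (f' x)) ->
  exists2 c, `|c - a| <= `|b - a| & f b - f a = f' c * (b - a).
Proof.
move=> df.
have cf : continuous f.
  by move=> x; apply/differentiable_continuous/derivable1_diffP; case: (df x).
have [ab|/ltW ba] := leP a b.
  have [//|c /itvP cab ->] := @MVT_segment R f f' a b ab (fun x _ => df x).
    exact: continuous_subspaceT.
  by exists c => //; rewrite !ger0_norm ?subr_ge0 ?lerD2r ?cab.
have [//|c /itvP cab e] := @MVT_segment R f f' b a ba (fun x _ => df x).
  exact: continuous_subspaceT.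
exists c; first by rewrite !ler0_norm ?subr_le0 ?lerN2 ?lerD2r ?cab.
by rewrite -[LHS]opprB e -mulrN opprB.
Qed.

(** Both increments, of [f] and then of [f'], are estimated by the mean value
theorem; the bound is uniform in [s]. *)
Lemma taylor1 (f f' f'' : R -> R) (M : R) s t :
  (forall x : R, is_derive x 1 f (f' x)) ->
  (forall x : R, is_derive x 1 f' (f'' x)) -> (forall x, `|f'' x| <= M) ->
  `|f (s + t) - f s - t * f' s| <= M * t ^+ 2.
Proof.
move=> df df' fM; have [c cs ->] := mean_value s (s + t) df.
have [d _ e] := mean_value s c df'.
have {}cs : `|c - s| <= `|t| by move: cs; rewrite (addrC s t) addrK.
have -> : f' c * (s + t - s) - t * f' s = t * (f' c - f' s) by ring.
rewrite e !normrM -(real_normK (num_real t)) expr2 mulrCA.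
by apply: ler_pM => //; exact: ler_wpM2l.
Qed.

Lemma supported_bounded phi : continuous phi -> supported phi ->
  exists M, forall t, `|phi t| <= M.
Proof.
move=> cphi sphi.
have pi0 : 0 <= 2 * pi :> R by rewrite mulr_ge0// pi_ge0.
have cn : {within `[0, 2 * pi], continuous (fun t => `|phi t|)}.
  apply: continuous_subspaceT => t; apply: (continuous_comp (cphi t)).
  exact: norm_continuous.
have [c _ Hc] := EVT_max pi0 cn; exists `|phi c| => t.
have [t0|t0] := leP t 0; first by rewrite sphi ?normr0//; left.
have [t2|t2] := leP (2 * pi) t; first by rewrite sphi ?normr0//; right.
by apply: Hc; rewrite in_itv /= !ltW.
Qed.

(** At the two boundary points this uses the continuity of the derivative. *)
Lemma supported_deriv phi phi' : continuous phi' ->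
  supported phi -> (forall x : R, is_derive x 1 phi (phi' x)) -> supported phi'.
Proof.
move=> cphi' sphi dphi.
have lt0 t : t < 0 \/ 2 * pi < t -> phi' t = 0.
  move=> ht; have near0 : \forall s \near t, 0 = phi s.
    case: ht => ht.
      by apply: filterS (lt_nbhsl ht) => s s0; rewrite sphi//; left; exact: ltW.
    by apply: filterS (lt_nbhsr ht) => s s0; rewrite sphi//; right; exact: ltW.
  have := near_eq_is_derive near0 (is_derive_cst (0:R) t 1).
  move=> h; rewrite -(@derive_val _ _ _ _ _ _ _ (dphi t)).
  by rewrite (@derive_val _ _ _ _ _ _ _ h).
have clos (x : R) : (forall e : R, 0 < e -> exists2 y, `|x - y| < e & phi' y = 0) -> phi' x = 0.
  move=> H; apply/eqP; apply: contraT => px; have := cphi' x.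
  move=> /cvgrPdist_lt /(_ `|phi' x|); rewrite normr_gt0 => /(_ px).
  move=> /nbhs_ballP[e /= e0 He]; have [y xy y0] := H e e0.
  by have := He y xy; rewrite y0 subr0 ltxx.
move=> t [|]; rewrite le_eqVlt => /orP[/eqP|] ht; try by apply: lt0; auto.
  apply: clos => e e0; exists (- (e / 2)); last by apply: lt0; left; lra.
  by rewrite ht opprK add0r gtr0_norm; lra.
apply: clos => e e0; exists (t + e / 2); last by apply: lt0; right; lra.
by rewrite opprD addNKr normrN gtr0_norm; lra.
Qed.

(** The difference quotients converge uniformly on the circle because the second
derivative is bounded; the sign comes from f_h (t) = f (t - h). *)
Lemma rot_deriv_scalar_loop phi phi' phi'' :
  (forall x : R, is_derive x 1 phi (phi' x)) ->
  (forall x : R, is_derive x 1 phi' (phi'' x)) ->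
  continuous phi'' -> supported phi ->
  curve_deriv (fun t => rot t (scalar_loop phi)) (scalar_loop (fun t => - phi' t)).
Proof.
move=> d1 d2 c2 s0; have pi0 := pi_gt0 R.
have cont (f f' : R -> R) : (forall x : R, is_derive x 1 f (f' x)) -> continuous f.
  by move=> df x; apply/differentiable_continuous/derivable1_diffP; case: (df x).
have c0 := cont _ _ d1; have c1 := cont _ _ d2.
have s1 := supported_deriv c1 s0 d1; have s2 := supported_deriv c2 s1 d2.
have cN : continuous (fun t => - phi' t) by move=> t; apply: cvgN; exact: c1.
have sN : supported (fun t => - phi' t) by move=> t /s1 ->; rewrite oppr0.
have [M HM] := supported_bounded c2 s2.
have M0 : 0 <= M by apply: le_trans (HM 0).
have M1 : 0 < 3 * M + 1 by lra.
apply/ncvgP => e e0.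
have : \forall t \near (0:R)^', `|t| < Num.min pi (e / (3 * M + 1)).
  by apply: dnbhs0_lt; rewrite lt_min pi0 divr_gt0.
have := nbhs_dnbhs_neq (0 : R).
apply: filterS2 => t t0; rewrite lt_min => /andP[tpi te].
apply: (@le_lt_trans _ _ (3 * M * `|t|)); last first.
  apply: (@le_lt_trans _ _ ((3 * M + 1) * `|t|)); first by rewrite ler_wpM2r// lerDl.
  by rewrite mulrC -ltr_pdivlMr.
apply: loop_norm_le => z; have [s /andP[s0' s2'] <-] := cis_surj z.
have /andP[t1 t2] : - pi < t < pi by rewrite -ltr_norml.
rewrite /= cisV cis0 invg1 mulg1 -cisD !scalar_loopE//; try by apply/andP; split; lra.
set lhs := (X in cnorm X <= _).
pose E u := t^-1 * (phi (u - t) - phi u - (- t) * phi' u).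
have EM u : `|E u| <= M * `|t|.
  rewrite /E normrM normfV ler_pdivrMl ?normr_gt0//.
  apply: le_trans (taylor1 u (- t) d1 d2 HM) _.
  by rewrite sqrrN -(real_normK (num_real t)) expr2; lra.
have -> : lhs = (E s + E (s + 2 * pi) + E (s - 2 * pi))%:C *: 1.
  have EE u : E u = t^-1 * (phi (u - t) - phi u) + phi' u by rewrite /E; field.
  rewrite /lhs -!scalerDl -scalerBl scalerA -scalerBl !EE; congr (_ *: _).
  rewrite (addrAC s (2 * pi)) (addrAC s (- (2 * pi))).
  by rewrite !(rmorphD, rmorphB, rmorphM, rmorphN) /=; ring.
have -> : cnorm ((E s + E (s + 2 * pi) + E (s - 2 * pi))%:C *: (1 : A)) =
    `|E s + E (s + 2 * pi) + E (s - 2 * pi)| * cnorm (1 : A).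
  by apply: (@complexI R); rewrite cnormZ [RHS]rmorphM normc_real.
rewrite cnorm1 mulr1.
apply: le_trans (ler_normD _ _) _; apply: le_trans (lerD (ler_normD _ _) (EM _)) _.
by have := lerD (EM s) (EM (s + 2 * pi)); lra.
Qed.

Lemma rot_Ck_scalar_loop k phi : real_smooth phi -> supported phi -> rot_Ck k (scalar_loop phi).
Proof.
elim: k phi => [//|k IH] phi sm su.
have [phi' d1 sm1] := real_smooth_deriv sm.
have [phi'' d2 sm2] := real_smooth_deriv sm1.
exists (scalar_loop (fun t => - phi' t)).
  by apply: rot_deriv_scalar_loop d1 d2 _ _ => //; exact: real_smooth_continuous.
have su1 : supported phi'.
  by apply: supported_deriv su d1; exact: real_smooth_continuous.
apply: IH.
  by move=> j; under eq_fun do rewrite -mulN1r; apply: real_CkM => //; exact: real_Ck_cst.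
by move=> t /su1 ->; rewrite oppr0.
Qed.

End SmoothLoops.
(** * Smooth elements of the suspended system *)

Section SuspensionSmoothness.
Variables (R : realType) (A : cstarAlgType R).
Implicit Types (a b : A) (L : loops A).

Lemma loop_norm_cst a : cnorm (loop_cst a) = cnorm a.
Proof.
apply/eqP; rewrite eq_le; apply/andP; split; first exact: loop_norm_le.
exact: (loop_norm_ub (loop_cst a) 1%g).
Qed.

Lemma loop_cstB a b : loop_cst (a - b) = loop_cst a - loop_cst b.
Proof. exact: loopP. Qed.

Lemma loop_cst_cvg (T : Type) (F : set_system T) (FF : Filter F) (f : T -> A) a :
  (f : T -> normed A) @ F --> (a : normed A) ->
  ((fun t => loop_cst (f t)) : T -> normed (loops A)) @ F -->
    (loop_cst a : normed (loops A)).
Proof.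
move=> /ncvgP Hf; apply/ncvgP => e /Hf; apply: filterS => t.
by rewrite -loop_cstB loop_norm_cst.
Qed.

Lemma curve_deriv_loop_cst (f : R -> A) l : curve_deriv f l ->
  curve_deriv (fun t => loop_cst (f t)) (loop_cst l).
Proof.
move=> fl; apply: (curve_deriv_from (loop_cst_cvg _ fl)) => t.
exact: loopP.
Qed.

Lemma class_Ck_sub (E : normedModType R[i]) k m (U V : set 'rV[R]_m)
  (f : 'rV[R]_m -> E) : V `<=` U -> class_Ck k U f -> class_Ck k V f.
Proof.
move=> VU; elim: k f => [|k IH] f [cf Df]; split=> //.
- by move=> x /VU; exact: cf.
- by move=> x /VU; exact: cf.
case: Df => D Df; exists D => i; have [pf /IH Ckf] := Df i; split=> //.
by move=> x /VU; exact: pf.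
Qed.

Lemma class_Ck_loop_cst k m j (U : set 'rV[R]_m) (f : 'rV[R]_m -> A) :
  class_Ck k U (f : _ -> normed A) ->
  class_Ck k [set x : 'rV[R]_(m + j) | U (lsubmx x)]
    ((fun x : 'rV[R]_(m + j) => loop_cst (f (lsubmx x))) : _ -> normed (loops A)).
Proof.
have cl (h : 'rV[R]_m -> A) (x : 'rV[R]_(m + j)) :
    {for lsubmx x, continuous (h : _ -> normed A)} ->
    {for x, continuous ((fun x => loop_cst (h (lsubmx x))) : _ -> normed (loops A))}.
  move=> ch.
  exact: (loop_cst_cvg _ (continuous_comp (@continuous_lsubmx _ _ _ _ x) ch)).
elim: k f => [|k IH] f [cf Df]; split=> //.
- by move=> x Ux; exact: (cl _ _ (cf _ Ux)).
- by move=> x Ux; exact: (cl _ _ (cf _ Ux)).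
case: Df => D Df.
exists (fun i x => match fintype.split i with
  | inl i' => loop_cst (D i' (lsubmx x) : A) | inr _ => 0 end) => i.
case: (splitP i) => i' ii'.
  have [pf Ckf] := Df i'; split; last exact: IH.
  move=> x Ux; have := curve_deriv_loop_cst (pf _ Ux); rewrite /has_partial.
  have -> // : (fun t => loop_cst (f (lsubmx x + t *: delta_mx 0 i'))) =
    (fun t => loop_cst (f (lsubmx (x + t *: delta_mx 0 i)))).
  apply/funext => t; do 2 congr (_ _); apply/rowP => s; rewrite !mxE; congr (_ + _ * _).
  by rewrite eqxx /= -!val_eqE /= ii'.
split; last exact: class_Ck_cst.
move=> x Ux; have := @curve_deriv_cst _ (loops A) (loop_cst (f (lsubmx x))).
rewrite /has_partial.
have -> // : (fun=> loop_cst (f (lsubmx x))) =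
    (fun t => loop_cst (f (lsubmx (x + t *: delta_mx 0 i)))).
apply/funext => t; do 2 congr (_ _); apply/rowP => s; rewrite !mxE.
rewrite (_ : lshift j s == i = false) ?andbF ?mulr0 ?addr0//.
by apply/negbTE; rewrite -val_eqE /= ii' neq_ltn ltn_addr.
Qed.

Lemma rotB y L L' : rot y (L - L') = rot y L - rot y L'.
Proof. exact: loopP. Qed.

Lemma rot_continuous L : rot_Ck 1 L -> continuous ((fun y => rot y L) : R -> normed (loops A)).
Proof.
move=> [L' dL _] y; have /ncvgP Hc := curve_deriv_cvg dL.
apply/ncvgP => e e0; have := Hc e e0.
rewrite near_withinE => /nbhs_ballP[d /= d0 Hd].
apply/nbhs_ballP; exists d => //= s ys.
rewrite -(subrKC y s) rotD -rotB rot_norm -[L in _ - L]rot0.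
have [->|ne] := eqVneq s y; first by rewrite !subrr cnorm0.
apply: Hd; last by rewrite subr_eq0.
by rewrite /ball /= sub0r opprB.
Qed.

(** The partial derivatives of the rotated loop are the rotations of its derivative,
which is again infinitely differentiable under rotations. *)
Lemma class_Ck_rot k m j (U : set 'rV[R]_(m + j.+1)) L : (forall k, rot_Ck k L) ->
  class_Ck k U ((fun x => rot (rsubmx x 0 0) L) : _ -> normed (loops A)).
Proof.
have cr L' : rot_Ck 1 L' -> forall x : 'rV[R]_(m + j.+1),
    {for x, continuous ((fun x => rot (rsubmx x 0 0) L') : _ -> normed (loops A))}.
  move=> rL x.
  have c1 := continuous_comp (@continuous_rsubmx R 1 m j.+1 x)
     (@coord_continuous R 1 j.+1 0 0 (rsubmx x)).
  exact: (continuous_comp c1 (@rot_continuous _ rL _)).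
move=> sL; have : rot_Ck k.+1 L by [].
elim: k L {sL} => [|k IH] L; move=> /[dup] HL [L' dL rL]; split=> //.
- by move=> x _; apply: cr; exists L'.
- by move=> x _; apply: cr; exists L'.
exists (fun i x => match fintype.split i with
  | inl _ => 0 | inr i' => if i' == 0 then rot (rsubmx x 0 0) L' else 0 end) => i.
have dconst x : (forall t, rsubmx (x + t *: delta_mx 0 i) 0 0 = rsubmx x 0 0) ->
  has_partial ((fun x => rot (rsubmx x 0 0) L) : _ -> normed (loops A)) i x 0.
  move=> e; have := @curve_deriv_cst _ (loops A) (rot (rsubmx x 0 0) L).
  rewrite /has_partial; have -> // : (fun=> rot (rsubmx x 0 0) L) =
    (fun t => rot (rsubmx (x + t *: delta_mx 0 i) 0 0) L).
  by apply/funext => t; rewrite e.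
case: (splitP i) => i' ii'.
  split; last exact: class_Ck_cst.
  move=> x _; apply: dconst => t; rewrite !mxE.
  rewrite (_ : rshift m 0 == i = false) ?andbF ?mulr0 ?addr0//.
  by apply/negbTE; rewrite -val_eqE /= ii' neq_ltn addn0 ltn_ord orbT.
case: eqP => [i0|/eqP i0]; last first.
  split; last exact: class_Ck_cst.
  move=> x _; apply: dconst => t; rewrite !mxE.
  rewrite (_ : rshift m 0 == i = false) ?andbF ?mulr0 ?addr0//.
  apply/negbTE; rewrite -val_eqE /= ii' eqn_add2l eq_sym.
  by rewrite -val_eqE in i0.
split; last exact: IH.
move=> x _.
have rl y l : curve_deriv (fun t => rot t L) l -> curve_deriv (fun t => rot y (rot t L)) (rot y l).
  move=> /ncvgP H; apply/ncvgP => e /H; apply: filterS => t.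
  by rewrite -(rot_norm y) rotB.
have := rl (rsubmx x 0 0) _ dL; rewrite /has_partial.
have -> // : (fun t => rot (rsubmx x 0 0) (rot t L)) =
    (fun t => rot (rsubmx (x + t *: delta_mx 0 i) 0 0) L).
apply/funext => t; rewrite -rotD; congr rot; rewrite !mxE eqxx.
by rewrite (_ : _ == i) ?mulr1// -val_eqE /= ii' i0.
Qed.

Variables (m : nat) (G : lieData R m) (alpha : cstar_action G A).

Lemma susp_action_cst g a : susp_action alpha g (loop_cst a) = loop_cst (alpha g.1 a).
Proof. exact: loopP. Qed.

Lemma scalar_loop_scalar (phi : R -> R) : continuous phi -> supported phi ->
  forall z, exists c, scalar_loop A phi z = c *: 1.
Proof.
move=> cphi sphi z; have [t /andP[t0 t2] <-] := cis_surj z.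
have pi0 := pi_gt0 R; rewrite scalar_loopE//; last by apply/andP; split; lra.
by rewrite -!scalerDl; eexists.
Qed.

Lemma susp_action_scalar_loop g (y : R) (phi : R -> R) : continuous phi -> supported phi ->
  susp_action alpha (g, cis y) (scalar_loop A phi) = rot y (scalar_loop A phi).
Proof.
move=> cphi sphi; apply: loopP => z /=.
have [c ->] := scalar_loop_scalar cphi sphi (z * (cis y)^-1)%g.
by rewrite actionZ action_unit.
Qed.

Lemma susp_actionD g L L' :
  susp_action alpha g (L + L') = susp_action alpha g L + susp_action alpha g L'.
Proof. by apply: loopP => z /=; rewrite actionD. Qed.

Lemma susp_actionM g L L' :
  susp_action alpha g (L * L') = susp_action alpha g L * susp_action alpha g L'.
Proof. by apply: loopP => z /=; rewrite actionM. Qed.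

Lemma smooth_elt_loop_cst a : smooth_elt alpha a ->
  smooth_elt (susp_action alpha) (loop_cst a).
Proof.
move=> sa _ [c1 [c2 [h1 h2 ->]]] k /=.
have := class_Ck_loop_cst 1 (sa c1 h1 k).
move=> /(@class_Ck_sub _ _ _ _ [set x | c1.1 (lsubmx x) /\ c2.1 (rsubmx x)]).
move=> H; have {H} := H (fun x => @proj1 _ _).
by congr class_Ck; apply/funext => x; rewrite susp_action_cst.
Qed.

Lemma smooth_elt_scalar_loop (phi : R -> R) : real_smooth phi -> supported phi ->
  smooth_elt (susp_action alpha) (scalar_loop A phi).
Proof.
move=> sphi su _ [c1 [_ [h1 [a ->] ->]]] k /=.
have := @class_Ck_rot k m 0 [set x | c1.1 (lsubmx x) /\ a - pi < rsubmx x 0 0 < a + pi]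
  _ (fun k => rot_Ck_scalar_loop A k sphi su).
congr class_Ck; apply/funext => x.
by rewrite susp_action_scalar_loop//; exact: real_smooth_continuous.
Qed.

End SuspensionSmoothness.
(** * Matrices over a C*-algebra *)

Section MatrixStar.
Variables (R : realType) (A : cstarAlgType R).
Implicit Types (r s : R).

Lemma adjmxE m n (M : 'M[A]_(m, n)) i j : adjmx M i j = star (M j i).
Proof. by rewrite !mxE. Qed.

Lemma star_sum (I : Type) (l : seq I) (F : I -> A) :
  star (\sum_(i <- l) F i) = \sum_(i <- l) star (F i).
Proof. by elim/big_rec2: _ => [|i a b _ <-]; rewrite ?star0// starD. Qed.

Lemma adjmxK m n (M : 'M[A]_(m, n)) : adjmx (adjmx M) = M.
Proof. by apply/matrixP => i j; rewrite !adjmxE starK. Qed.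

Lemma adjmxD m n (M N : 'M[A]_(m, n)) : adjmx (M + N) = adjmx M + adjmx N.
Proof. by apply/matrixP => i j; rewrite adjmxE [RHS]mxE !adjmxE mxE starD. Qed.

Lemma adjmxN m n (M : 'M[A]_(m, n)) : adjmx (- M) = - adjmx M.
Proof. by apply/matrixP => i j; rewrite adjmxE [RHS]mxE !adjmxE mxE starN. Qed.

Lemma adjmx0 m n : adjmx (0 : 'M[A]_(m, n)) = 0.
Proof. by apply/matrixP => i j; rewrite adjmxE !mxE star0. Qed.

Lemma adjmx_scalar n (a : A) : adjmx (a%:M : 'M[A]_n) = (star a)%:M.
Proof.
by apply/matrixP => i j; rewrite adjmxE !mxE eq_sym; case: eqP; rewrite ?star0.
Qed.

Lemma adjmx1 n : adjmx (1%:M : 'M[A]_n) = 1%:M.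
Proof. by rewrite adjmx_scalar star1. Qed.

Lemma adjmxM m n k (M : 'M[A]_(m, n)) (N : 'M[A]_(n, k)) :
  adjmx (M *m N) = adjmx N *m adjmx M.
Proof.
apply/matrixP => i j; rewrite adjmxE !mxE star_sum; apply: eq_bigr => l _.
by rewrite starM !adjmxE.
Qed.

Lemma adjmx_col m1 m2 n (M : 'M[A]_(m1, n)) (N : 'M[A]_(m2, n)) :
  adjmx (col_mx M N) = row_mx (adjmx M) (adjmx N).
Proof. by rewrite /adjmx map_col_mx tr_col_mx. Qed.

Lemma adjmx_block m1 m2 n1 n2 (M : 'M[A]_(m1, n1)) (N : 'M[A]_(m1, n2))
    (P : 'M[A]_(m2, n1)) (Q : 'M[A]_(m2, n2)) :
  adjmx (block_mx M N P Q) = block_mx (adjmx M) (adjmx P) (adjmx N) (adjmx Q).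
Proof. by rewrite /adjmx map_block_mx tr_block_mx. Qed.

(** Scaling by a real number: the matrices carry a module structure over [A], not
over the complex numbers. *)
Definition rmx m n r (M : 'M[A]_(m, n)) : 'M[A]_(m, n) := map_mx ( *:%R r%:C) M.

Lemma rmxE m n r (M : 'M[A]_(m, n)) i j : rmx r M i j = r%:C *: M i j.
Proof. by rewrite mxE. Qed.

Lemma rmxMl m n k r (M : 'M[A]_(m, n)) (N : 'M[A]_(n, k)) :
  rmx r M *m N = rmx r (M *m N).
Proof.
apply/matrixP => i j; rewrite rmxE !mxE scaler_sumr; apply: eq_bigr => l _.
by rewrite rmxE scalerAl.
Qed.

Lemma rmxMr m n k r (M : 'M[A]_(m, n)) (N : 'M[A]_(n, k)) :
  M *m rmx r N = rmx r (M *m N).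
Proof.
apply/matrixP => i j; rewrite rmxE !mxE scaler_sumr; apply: eq_bigr => l _.
by rewrite rmxE scalerAr.
Qed.

Lemma rmxA m n r s (M : 'M[A]_(m, n)) : rmx r (rmx s M) = rmx (r * s) M.
Proof. by apply/matrixP => i j; rewrite !rmxE scalerA rmorphM. Qed.

Lemma rmxDr m n r (M N : 'M[A]_(m, n)) : rmx r (M + N) = rmx r M + rmx r N.
Proof. by apply/matrixP => i j; rewrite rmxE [RHS]mxE !rmxE mxE scalerDr. Qed.

Lemma rmxNr m n r (M : 'M[A]_(m, n)) : rmx r (- M) = - rmx r M.
Proof. by apply/matrixP => i j; rewrite rmxE [RHS]mxE !rmxE mxE scalerN. Qed.

Lemma rmxDl m n r s (M : 'M[A]_(m, n)) : rmx (r + s) M = rmx r M + rmx s M.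
Proof. by apply/matrixP => i j; rewrite rmxE [RHS]mxE !rmxE rmorphD scalerDl. Qed.

Lemma rmxNl m n r (M : 'M[A]_(m, n)) : rmx (- r) M = - rmx r M.
Proof. by apply/matrixP => i j; rewrite rmxE [RHS]mxE !rmxE rmorphN scaleNr. Qed.

Lemma rmx1 m n (M : 'M[A]_(m, n)) : rmx 1 M = M.
Proof. by apply/matrixP => i j; rewrite !rmxE scale1r. Qed.

Lemma rmx0 m n r : rmx r (0 : 'M[A]_(m, n)) = 0.
Proof. by apply/matrixP => i j; rewrite !rmxE mxE scaler0. Qed.

Lemma rmx0l m n (M : 'M[A]_(m, n)) : rmx 0 M = 0.
Proof. by apply/matrixP => i j; rewrite !rmxE mxE scale0r. Qed.

Lemma star_real r (a : A) : star (r%:C *: a) = r%:C *: star a.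
Proof. by rewrite starZ conj_Creal// complex_real. Qed.

Lemma adjmx_rmx m n r (M : 'M[A]_(m, n)) : adjmx (rmx r M) = rmx r (adjmx M).
Proof. by apply/matrixP => i j; rewrite !(adjmxE, rmxE) star_real. Qed.

Lemma rmx_col m1 m2 n r (M : 'M[A]_(m1, n)) (N : 'M[A]_(m2, n)) :
  rmx r (col_mx M N) = col_mx (rmx r M) (rmx r N).
Proof. by rewrite /rmx map_col_mx. Qed.

Lemma scalar_rmx n r : (r%:C%:A)%:M = rmx r 1%:M :> 'M[A]_n.
Proof. by apply/matrixP => i j; rewrite rmxE !mxE; case: eqP; rewrite ?scaler0. Qed.

Lemma scalar_rmxN n r : (- r%:C%:A)%:M = rmx (- r) 1%:M :> 'M[A]_n.
Proof. by rewrite -scalar_rmx -scaleNr (rmorphN (real_complex R)). Qed.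

End MatrixStar.

(** * The first column of the clutching matrix *)

Section ClutchingColumn.
Variables (R : realType) (A : cstarAlgType R) (n : nat) (u : 'M[A]_n).
Implicit Types x y z : R.

(** The vectors of which the first column of the clutching matrix is a real
combination, with weights cos^2, sin^2 and cos sin of theta / 4. *)
Definition column1 : 'M[A]_(n + n, n) := col_mx 1%:M 0.
Definition column2 : 'M[A]_(n + n, n) := col_mx u 0.
Definition column3 : 'M[A]_(n + n, n) := col_mx 0 (adjmx u - 1%:M).

Definition column x y z := rmx x column1 + rmx y column2 + rmx z column3.

Lemma columnE x y z : column x y z =
  col_mx (rmx x 1%:M + rmx y u) (rmx z (adjmx u - 1%:M)).
Proof. by rewrite /column !rmx_col !add_col_mx !rmx0 !addr0 !add0r. Qed.

Lemma adjmx_column x y z : adjmx (column x y z) =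
  row_mx (rmx x 1%:M + rmx y (adjmx u)) (rmx z (u - 1%:M)).
Proof. by rewrite columnE adjmx_col !adjmxD !adjmx_rmx adjmxD adjmxN adjmxK adjmx1. Qed.

Hypothesis hu : unitary u.

Lemma column1_range : column1 *m adjmx column1 = dsum 1%:M 0.
Proof. by rewrite /column1 adjmx_col adjmx1 adjmx0 mul_col_row !mul1mx !mul0mx. Qed.

Lemma column2_range : column2 *m adjmx column2 = dsum 1%:M 0.
Proof.
by case: hu => uu _; rewrite /column2 adjmx_col adjmx0 mul_col_row uu !mulmx0 !mul0mx.
Qed.

(** The blocks are polynomials in [u] and [u^*]; the terms with [u] and with [u^*]
cancel by z^2 = x y and what remains is (x + y)^2. *)
Lemma column_isometry x y z : x + y = 1 -> z ^+ 2 = x * y ->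
  adjmx (column x y z) *m column x y z = 1%:M.
Proof.
move=> xy zxy; rewrite adjmx_column columnE mul_row_col.
rewrite !(rmxMl, rmxMr, rmxA) !(mulmxDl, mulmxDr, mulmxN, mulNmx, mul1mx, mulmx1).
case: hu => uu uu'; rewrite !(rmxMl, rmxMr, rmxA, rmxDr, rmxNr, rmxNl, mulmx1, mul1mx) uu uu'.
rewrite -(expr2 z) zxy (mulrC y x) opprK.
(* The permutation brings the constant terms first, then the pairs that cancel. *)
rewrite [LHS](AC ((2*2)*(2*2)) ((1*4*5*8)*(2*6)*(3*7))) /=.
rewrite !subrr !addr0 -!rmxDl.
have -> : x * x + y * y + x * y + x * y = 1 by rewrite -(expr1n _ 2) -xy; ring.
by rewrite rmx1.
Qed.

(** Since diag (1, 0) is [column1] times its adjoint, the clutching projection is the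
range projection of the first column of the clutching matrix. *)
Lemma clutching_column t : clutching_projection u t =
  let V := column (cos (t / 4) ^+ 2) (sin (t / 4) ^+ 2) (cos (t / 4) * sin (t / 4)) in
  V *m adjmx V.
Proof.
rewrite /clutching_projection -column1_range mulmxA -mulmxA -adjmxM.
suff -> : clutching u t *m column1 = column (cos (t / 4) ^+ 2) (sin (t / 4) ^+ 2)
   (cos (t / 4) * sin (t / 4)) by [].
rewrite /clutching /rotation /dsum scalar_rmxN !scalar_rmx adjmx_block.
rewrite !adjmx_rmx !adjmx1 -!mulmxA columnE /column1 !mul_block_col.
rewrite !(mulmx0, mul0mx, mulmx1, mul1mx, addr0, add0r) !(rmxMl, rmxMr).
rewrite !(mulmx0, mul0mx, mulmx1, mul1mx, addr0, add0r, mulmxDr, rmxMl, rmxMr, rmxDr, rmxA).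
case: hu => -> _; rewrite -!expr2 sqrrN mulrN rmxNl rmxNr (mulrC (sin _)).
by [].
Qed.

Let P : 'M[A]_(n + n) := dsum 1%:M 0.

Definition coef0 := column3 *m adjmx column3 + column1 *m adjmx column2 +
  column2 *m adjmx column1 - (P + P).
Definition coef1 := column1 *m adjmx column3 + column3 *m adjmx column1.
Definition coef2 := column2 *m adjmx column3 + column3 *m adjmx column2.

(** Only the products x y, x z and y z occur: z^2 = x y, and x^2 + y^2 = 1 - 2 x y
multiplies the common range projection of [column1] and [column2]. *)
Lemma column_projection x y z : x + y = 1 -> z ^+ 2 = x * y ->
  column x y z *m adjmx (column x y z) =
  P + rmx (x * y) coef0 + rmx (x * z) coef1 + rmx (y * z) coef2.
Proof.
move=> xy zxy.
rewrite /column !adjmxD !adjmx_rmx !(mulmxDl, mulmxDr, rmxMl, rmxMr, rmxA).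
rewrite column1_range column2_range.
rewrite /coef0 /coef1 /coef2 !(rmxDr, rmxNr, rmxA) -(expr2 z) zxy.
rewrite (mulrC y x) (mulrC z x) (mulrC z y).
(* The permutation groups the nine products by their weights. *)
rewrite [LHS](AC (3*3*3) (((1*5)*(9*2*4))*(3*7)*(6*8))) /=.
rewrite -(rmxDl (x * x)) (_ : x * x + y * y = 1 - (x * y + x * y)); last first.
  by rewrite -(expr1n _ 2) -xy; ring.
rewrite rmxDl rmx1 rmxNl rmxDl; congr (_ + _ + _).
by rewrite -[LHS]addrA; congr (_ + _); exact: addrC.
Qed.

End ClutchingColumn.
(** * Curves of matrices *)

Section MatrixCurves.
Variables (R : realType) (A : cstarAlgType R).

Definition mx_deriv m n (C : R -> 'M[A]_(m, n)) (L : 'M[A]_(m, n)) :=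
  forall i j, curve_deriv (fun t => C t i j) (L i j).

Lemma mx_deriv_ext m n (C D : R -> 'M[A]_(m, n)) L :
  (forall t, C t = D t) -> mx_deriv C L -> mx_deriv D L.
Proof. by move=> /funext ->. Qed.

Lemma mx_deriv_unique m n (C : R -> 'M[A]_(m, n)) L L' :
  mx_deriv C L -> mx_deriv C L' -> L = L'.
Proof.
move=> CL CL'; apply/matrixP => i j; exact: curve_deriv_unique (CL i j) (CL' i j).
Qed.

Lemma mx_deriv_cst m n (M : 'M[A]_(m, n)) : mx_deriv (fun=> M) 0.
Proof. by move=> i j; rewrite mxE; exact: curve_deriv_cst. Qed.

Lemma mx_derivD m n (C D : R -> 'M[A]_(m, n)) L K : mx_deriv C L -> mx_deriv D K ->
  mx_deriv (fun t => C t + D t) (L + K).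
Proof.
move=> CL DK i j; rewrite mxE; under eq_fun do rewrite mxE.
exact: curve_derivD.
Qed.

Lemma mx_derivM m n k (C : R -> 'M[A]_(m, n)) (D : R -> 'M[A]_(n, k)) L K :
  mx_deriv C L -> mx_deriv D K ->
  mx_deriv (fun t => C t *m D t) (L *m D 0 + C 0 *m K).
Proof.
move=> CL DK i j; rewrite !mxE -big_split /=; under eq_fun do rewrite mxE.
by apply: curve_deriv_sum => l; exact: curve_derivM.
Qed.

Lemma mx_deriv_adj m n (C : R -> 'M[A]_(m, n)) L : mx_deriv C L ->
  mx_deriv (fun t => adjmx (C t)) (adjmx L).
Proof.
move=> CL i j; rewrite adjmxE; under eq_fun do rewrite adjmxE.
exact: curve_deriv_star.
Qed.

Lemma mx_deriv_rmx m n r (C : R -> 'M[A]_(m, n)) L : mx_deriv C L ->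
  mx_deriv (fun t => rmx r (C t)) (rmx r L).
Proof.
move=> CL i j; rewrite rmxE; under eq_fun do rewrite rmxE.
exact: curve_derivZ.
Qed.

Lemma mx_deriv_real m n (phi : R -> R) (x d : R) (M : 'M[A]_(m, n)) :
  is_derive x 1 phi d -> mx_deriv (fun t => rmx (phi (x + t)) M) (rmx d M).
Proof.
move=> dphi i j; rewrite rmxE; under eq_fun do rewrite rmxE.
exact: curve_deriv_real.
Qed.

Lemma mx_deriv_col m1 m2 n (C : R -> 'M[A]_(m1, n)) (D : R -> 'M[A]_(m2, n)) L K :
  mx_deriv C L -> mx_deriv D K -> mx_deriv (fun t => col_mx (C t) (D t)) (col_mx L K).
Proof.
move=> CL DK i j; rewrite mxE; under eq_fun do rewrite mxE.
case: (fintype.split i) => k; [exact: (CL k j)|exact: (DK k j)].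
Qed.

Lemma mx_deriv_isometry m n (C : R -> 'M[A]_(m, n)) L :
  (forall t, adjmx (C t) *m C t = 1%:M) -> mx_deriv C L ->
  adjmx L *m C 0 + adjmx (C 0) *m L = 0.
Proof.
move=> C1 CL; apply: mx_deriv_unique (mx_derivM (mx_deriv_adj CL) CL) _.
by under eq_fun do rewrite C1; exact: mx_deriv_cst.
Qed.

Lemma mx_deriv_range_projection m n (C : R -> 'M[A]_(m, n)) L : mx_deriv C L ->
  mx_deriv (fun t => C t *m adjmx (C t)) (L *m adjmx (C 0) + C 0 *m adjmx L).
Proof. by move=> CL; exact: mx_derivM (mx_deriv_adj CL). Qed.

End MatrixCurves.

(** * Traces and the curvature of a projection *)

Section Trace.
Variables (R : realType) (m : nat) (G : lieData R m) (A : cstarAlgType R).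
Variables (alpha : G -> A -> A) (tau : A -> R[i]).
Hypothesis htau : is_trace alpha tau.

Lemma trace0 : tau 0 = 0.
Proof. by rewrite -(scale0r 0) (traceZ htau) mul0r. Qed.

Lemma traceN a : tau (- a) = - tau a.
Proof. by rewrite -scaleN1r (traceZ htau) mulN1r. Qed.

Lemma trace_sum (I : Type) (r : seq I) (F : I -> A) :
  tau (\sum_(i <- r) F i) = \sum_(i <- r) tau (F i).
Proof. by elim/big_rec2: _ => [|i a b _ <-]; rewrite ?trace0// (traceD htau). Qed.

Lemma mxtraceC k l (M : 'M[A]_(k, l)) (N : 'M[A]_(l, k)) :
  tau (\tr (M *m N)) = tau (\tr (N *m M)).
Proof.
rewrite /mxtrace !trace_sum; under eq_bigr do rewrite mxE trace_sum.
rewrite exchange_big; apply: eq_bigr => i _; rewrite mxE trace_sum.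
by apply: eq_bigr => j _; rewrite (traceC htau).
Qed.

Lemma mxtrace_D k (M N : 'M[A]_k) : tau (\tr (M + N)) = tau (\tr M) + tau (\tr N).
Proof. by rewrite raddfD (traceD htau). Qed.

Lemma mxtrace_N k (M : 'M[A]_k) : tau (\tr (- M)) = - tau (\tr M).
Proof. by rewrite raddfN traceN. Qed.

Lemma mxtrace_rmx k r (M : 'M[A]_k) : tau (\tr (rmx r M)) = r%:C * tau (\tr M).
Proof.
rewrite -(traceZ htau) /mxtrace scaler_sumr; congr tau; apply: eq_bigr => i _.
exact: rmxE.
Qed.

(** This is how invariance of the trace makes it vanish on derivations. *)
Lemma trace_curve_deriv (C : R -> A) (l : A) : curve_deriv C l ->
  (forall t, tau (C t) = tau (C 0)) -> tau l = 0.
Proof.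
move=> Cl Cinv.
have tc : (tau (diff_quot (C : R -> normed A) t) : R[i]^o) @[t --> (0:R)^'] --> (tau l : R[i]^o).
  exact: (cvg_comp _ _ Cl (@trace_continuous _ _ _ _ _ _ htau l)).
have z t : tau (diff_quot (C : R -> normed A) t) = 0.
  by rewrite /diff_quot (traceZ htau) (traceD htau) traceN Cinv subrr mulr0.
have : (fun t : R => tau (diff_quot (C : R -> normed A) t) : R[i]^o) = (fun=> 0).
  by apply/funext.
move=> e; rewrite e in tc.
exact: (@cvg_unique _ (@norm_hausdorff _ (R[i]^o)) _ _ _ _ tc (cvg_cst _)).
Qed.

Lemma mxtrace_deriv k (C : R -> 'M[A]_k) L : mx_deriv C L ->
  (forall t i, tau (C t i i) = tau (C 0 i i)) -> tau (\tr L) = 0.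
Proof.
move=> CL inv; rewrite /mxtrace trace_sum big1// => i _.
by apply: trace_curve_deriv (CL i i) _ => t; exact: inv.
Qed.

(** With W = V^*, W p1 = W V1 W + V1^* and p2 V = V2 - V W V2 by the isometry
relation and its derivatives. Hence W p1 p2 V = V1^* V2 + (W V1) (W V2), and the
last product disappears in the commutator under the trace. *)
Lemma projection_curvature k l (V V1 V2 : 'M[A]_(k, l)) :
  adjmx V *m V = 1%:M ->
  adjmx V1 *m V + adjmx V *m V1 = 0 -> adjmx V2 *m V + adjmx V *m V2 = 0 ->
  let p := V *m adjmx V in
  let p1 := V1 *m adjmx V + V *m adjmx V1 in
  let p2 := V2 *m adjmx V + V *m adjmx V2 in
  tau (\tr (p *m (p1 *m p2 - p2 *m p1))) =
  tau (\tr (adjmx V1 *m V2)) - tau (\tr (adjmx V2 *m V1)).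
Proof.
set W := adjmx V => VV h1 h2 p p1 p2.
have e1 : adjmx V1 *m V = - (W *m V1) by apply/eqP; rewrite -addr_eq0 h1.
have e2 : adjmx V2 *m V = - (W *m V2) by apply/eqP; rewrite -addr_eq0 h2.
have half (U U' : 'M[A]_(k, l)) :
    adjmx U *m V = - (W *m U) -> adjmx U' *m V = - (W *m U') ->
    W *m ((U *m W + V *m adjmx U) *m (U' *m W + V *m adjmx U')) *m V =
    adjmx U *m U' + W *m U *m (W *m U').
  move=> eU eU'.
  have -> : W *m ((U *m W + V *m adjmx U) *m (U' *m W + V *m adjmx U')) *m V =
      (W *m (U *m W + V *m adjmx U)) *m ((U' *m W + V *m adjmx U') *m V).
    by rewrite !mulmxA.
  have -> : W *m (U *m W + V *m adjmx U) = W *m U *m W + adjmx U.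
    by rewrite mulmxDr !mulmxA VV mul1mx.
  have -> : (U' *m W + V *m adjmx U') *m V = U' - V *m (W *m U').
    by rewrite mulmxDl -!mulmxA VV eU' mulmx1 mulmxN.
  rewrite mulmxBr [X in _ - X]mulmxDl (mulmxA (adjmx U) V) eU.
  rewrite (mulmxA _ V) -(mulmxA _ W V) VV mulmx1 mulNmx subrr subr0 mulmxDl addrC.
  by rewrite !mulmxA.
rewrite /p -mulmxA mxtraceC -[W *m _ *m V]/(W *m _ *m V) mulmxBr mulmxBl.
rewrite (half _ _ e1 e2) (half _ _ e2 e1) mxtrace_D mxtrace_N !mxtrace_D (mxtraceC (W *m V1)).
ring.
Qed.

End Trace.
(** * The Chern form in dimension two *)

Section DegreeOfForms.
Variables (m : nat) (K : pzRingType).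
Implicit Types (w : Defs.form m K) (S T : {set 'I_m}).

Definition homogeneous (d : nat) w := forall S, #|S| != d -> w S = 0.

Lemma wedge_form0l (a : K) w S : wedge (form0 m a) w S = a * w S.
Proof.
rewrite ffunE (bigD1 finset.set0) ?finset.sub0set//= big1 => [|T /andP[_ T0]].
  rewrite ffunE eqxx finset.setD0 addr0 /inversions (eq_card0 (A := _)) ?mul1r//.
  by move=> ij; rewrite !inE.
by rewrite ffunE (negbTE T0) mul0r mulr0.
Qed.

Lemma wedge_form0r (a : K) w S : wedge w (form0 m a) S = w S * a.
Proof.
rewrite ffunE (bigD1 S) ?subxx//= big1 => [|T /andP[TS TS']].
  rewrite ffunE finset.setDv eqxx addr0 /inversions (eq_card0 (A := _)) ?mul1r//.
  by move=> ij; rewrite !inE andbF.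
rewrite ffunE; case: eqP => [/eqP|_]; last by rewrite !mulr0.
by rewrite finset.setD_eq0 => ST; case/negP: TS'; rewrite finset.eqEsubset TS.
Qed.

Lemma homogeneous_wedge (d e : nat) w w' :
  homogeneous d w -> homogeneous e w' -> homogeneous (d + e)%N (wedge w w').
Proof.
move=> hw hw' S Sde; rewrite ffunE big1// => T TS.
have [Td|/hw ->] := eqVneq #|T| d; last by rewrite mul0r mulr0.
rewrite (hw' (S :\: T)%SET) ?mulr0//; apply: contra Sde => /eqP <-.
by rewrite -(cardsID T S) (finset.setIidPr TS) Td.
Qed.

Lemma homogeneous_form0 a : homogeneous 0%N (form0 m a).
Proof. by move=> S; rewrite ffunE cards_eq0 => /negbTE ->. Qed.

Lemma homogeneous_dual_basis S : homogeneous #|S| (dual_basis K S).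
Proof. by move=> T TS; rewrite ffunE; case: (eqVneq T S) TS => [->|//]; rewrite eqxx. Qed.

End DegreeOfForms.

Section TwoForms.
Implicit Types S T : {set 'I_(1 + 1)}.

Let l : 'I_(1 + 1) := lshift 1 ord0.
Let r : 'I_(1 + 1) := rshift 1 ord0.

Lemma card_subset2 S : (#|S| <= 2)%N.
Proof. by rewrite (leq_trans (max_card _))// card_ord. Qed.

Lemma card_subset2_full S : #|S| = 2%N -> S = [set: 'I_(1 + 1)]%SET.
Proof. by move=> S2; apply/eqP; rewrite eqEcard finset.subsetT finset.cardsT card_ord S2. Qed.

Lemma ord2_cases (i : 'I_(1 + 1)) : i = l \/ i = r.
Proof. by case: i => -[|[|//]] h; [left|right]; apply: val_inj. Qed.

Lemma wedge_1_1 (K : pzRingType) (w w' : Defs.form (1 + 1) K) :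
  homogeneous 1%N w ->
  wedge w w' [set: 'I_(1 + 1)]%SET =
  w [set l]%SET * w' [set r]%SET - w [set r]%SET * w' [set l]%SET.
Proof.
move=> hw; rewrite ffunE (bigD1 [set l]%SET) ?finset.subsetT//=.
rewrite (bigD1 [set r]%SET) /=; last first.
  by rewrite finset.subsetT /=; apply/eqP => /finset.setP/(_ l); rewrite !inE.
rewrite big1 ?addr0; last first.
  move=> T /andP[/andP[_ Tl] Tr]; rewrite hw ?mul0r ?mulr0//.
  apply: contra Tl => /cards1P[i Ti]; move: Tr; rewrite {}Ti.
  by case: (ord2_cases i) => ->; rewrite ?eqxx.
have -> : ([set: 'I_(1 + 1)] :\ l = [set r])%SET.
  by apply/finset.setP => i; rewrite !inE; case: (ord2_cases i) => ->.
have -> : ([set: 'I_(1 + 1)] :\ r = [set l])%SET.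
  by apply/finset.setP => i; rewrite !inE; case: (ord2_cases i) => ->.
have -> : inversions [set l]%SET [set r]%SET = 0%N.
  apply: eq_card0 => -[i j]; rewrite !inE /=.
  by apply/negbTE/negP => /and3P[/eqP -> /eqP ->].
have -> : inversions [set r]%SET [set l]%SET = 1%N.
  transitivity #|[set (r, l)]%SET|; last exact: cards1.
  apply: eq_card => -[i j].
  rewrite !inE xpair_eqE /=.
  by case: (ord2_cases i) => ->; case: (ord2_cases j) => ->.
by rewrite expr0 expr1 mul1r mulN1r.
Qed.

(** In the suspension the odd part of the class is multiplied by dtheta, which makes
c X^* the form c X^* /\ dtheta of top degree. *)
Lemma chern_target (R : realType) (c : R[i]) S :
  let w := wedge (form0 1 c) (dual_basis R[i] [set ord0]%SET) in
  (pull (even_part w) + wedge (pull (odd_part w)) (dtheta R 1)) S =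
  if #|S| == 2%N then c else 0.
Proof.
move=> w; have wE (T : {set 'I_1}) : w T = c * (T == [set ord0]%SET)%:R.
  by rewrite /w wedge_form0l ffunE.
clearbody w.
have ev : even_part w = 0.
  apply/ffunP => T; rewrite !ffunE; case: ifP => // oT; rewrite wE.
  by case: eqP oT => [->|]; rewrite ?cards1// mulr0.
have od : odd_part w = w.
  apply/ffunP => T; rewrite !ffunE; case: ifP => // oT; rewrite wE.
  by case: eqP oT => [->|]; rewrite ?cards1// mulr0.
have pE (T : {set 'I_(1 + 1)}) : pull w T = c * (T == [set l]%SET)%:R.
  rewrite ffunE big_mkcond (bigD1 [set ord0]%SET)//= big1 => [|U /negbTE U0].
    by rewrite addr0 wE eqxx imset_set1 eq_sym; case: ifP; rewrite ?mulr0.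
  by rewrite wE U0 mulr0 if_same.
have ph : homogeneous 1%N (pull w).
  move=> T T1; rewrite pE (negbTE (_ : T != _)) ?mulr0//.
  by apply: contra T1 => /eqP ->; rewrite cards1.
rewrite ev od ffunE (_ : pull 0 S = 0) ?add0r; last first.
  by rewrite ffunE big1// => T _; rewrite ffunE.
have [S2|S2] := eqVneq #|S| 2%N.
  rewrite (card_subset2_full S2) wedge_1_1// !pE /dtheta !ffunE eqxx.
  have -> : ([set r] == [set l] :> {set 'I_(1 + 1)})%SET = false.
    by apply/eqP => /finset.setP/(_ l); rewrite !inE.
  by rewrite eqxx mulr0 mul0r subr0 !mulr1.
have hd : homogeneous 1%N (dtheta R 1).
  by have := @homogeneous_dual_basis (1 + 1) R[i] [set r]%SET; rewrite cards1.
exact: (homogeneous_wedge ph hd).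
Qed.

Variables (R : realType) (G : lieData R (1 + 1)) (A : cstarAlgType R).
Variables (alpha : G -> A -> A) (tau : A -> R[i]) (X : 'I_(1 + 1) -> R -> G).
Hypothesis tau0 : tau 0 = 0.

Lemma homogeneous_diff_mx k (p : 'M[A]_k) : homogeneous 1%N (diff_mx alpha X p).
Proof.
move=> S S1; rewrite ffunE big1// => i /eqP Si.
by move: S1; rewrite Si cards1.
Qed.

Lemma diff_mx1 k (p : 'M[A]_k) i :
  diff_mx alpha X p [set i]%SET = map_mx (derivation alpha (X i)) p.
Proof.
rewrite ffunE (big_pred1 i)// => j; rewrite /= eq_sym.
by apply/eqP/eqP => [/finset.setP/(_ i)|->//]; rewrite !inE eqxx => /eqP ->.
Qed.

(** The j-th term of the Chern character lives in degree 2 j. *)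
Lemma sum_even_degrees (c t : nat -> R[i]) (d : nat) : (d <= 2)%N ->
  (forall j, d != (2 * j)%N -> t j = 0) ->
  \sum_(j < 3) c j * t j =
  if d == 0%N then c 0%N * t 0%N else if d == 2%N then c 1%N * t 1%N else 0.
Proof.
move=> d2 t0; rewrite !big_ord_recl big_ord0 addr0 /=.
case: d d2 t0 => [|[|[|//]]] _ t0 /=.
- by rewrite (t0 1%N)// (t0 2%N)// !mulr0 !addr0.
- by rewrite (t0 0%N)// (t0 1%N)// (t0 2%N)// !mulr0 !addr0.
by rewrite (t0 0%N)// (t0 2%N)// !mulr0 addr0 add0r.
Qed.

Lemma chern_formE k (p : 'M[A]_k) S :
  let D i := map_mx (derivation alpha (X i)) p in
  chern_form alpha tau X p S =
  if #|S| == 0%N then tau (\tr p)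
  else if #|S| == 2%N then
    (2 * pi%:C * 'i%C)^-1 * tau (\tr (p *m (D l *m D r - D r *m D l)))
  else 0.
Proof.
move=> D; rewrite ffunE.
set dp := diff_mx alpha X p.
have hdp : homogeneous 1%N dp by exact: homogeneous_diff_mx.
pose c j : R[i] := ((2 * pi%:C * 'i%C) ^+ j * (j`!)%:R)^-1.
pose it j := iter j (wedge (wedge dp dp)) (form0 (1 + 1) (1%:M : 'M[A]_k)).
pose t j := tau (\tr (wedge (form0 (1 + 1) p) (it j) S)).
have hit j : homogeneous (2 * j)%N (it j).
  elim: j => [|j IH]; first exact: homogeneous_form0.
  by rewrite mulnS; apply: homogeneous_wedge IH; exact: (homogeneous_wedge hdp hdp).
have t0 j : #|S| != (2 * j)%N -> t j = 0.
  by move=> Sj; rewrite /t wedge_form0l (hit j _ Sj) mulr0 raddf0 tau0.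
rewrite (sum_even_degrees c (card_subset2 S) t0) /c /t.
rewrite expr0 expr1 !mul1r !mulr1 invr1 mul1r !wedge_form0l /it wedge_form0r.
case: ifP => [S0|S0]; first by rewrite ffunE -cards_eq0 S0 mulr1.
case: ifP => [/eqP/card_subset2_full ->|//].
by rewrite mulr1 (wedge_1_1 _ hdp) !diff_mx1.
Qed.

End TwoForms.
(** * Matrices of loops *)

Section MatrixLoops.
Variables (R : realType) (A : cstarAlgType R).
Implicit Types z : circle R.

Definition mx_continuous m n (C : R -> 'M[A]_(m, n)) :=
  forall i j, continuous ((fun t => C t i j) : R -> normed A).

Lemma mx_continuousM m n k (C : R -> 'M[A]_(m, n)) (D : R -> 'M[A]_(n, k)) :
  mx_continuous C -> mx_continuous D -> mx_continuous (fun t => C t *m D t).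
Proof.
move=> cC cD i j; under eq_fun do rewrite mxE.
have H (r : seq 'I_n) : continuous ((fun t => \sum_(l <- r) C t i l * D t l j) : R -> normed A).
  elim: r => [|l r IH].
    rewrite (_ : (fun _ => _) = fun=> 0); first exact: ncst_continuous.
    by apply/funext => t; rewrite big_nil.
  rewrite (_ : (fun _ => _) = fun t => C t i l * D t l j + \sum_(l <- r) C t i l * D t l j).
    by apply: nadd_continuous => //; exact: nmul_continuous.
  by apply/funext => t; rewrite big_cons.
exact: H.
Qed.

Lemma mx_continuous_adj m n (C : R -> 'M[A]_(m, n)) :
  mx_continuous C -> mx_continuous (fun t => adjmx (C t)).
Proof.
by move=> cC i j; under eq_fun do rewrite adjmxE; exact: nstar_continuous.
Qed.

Lemma mx_continuousD m n (C D : R -> 'M[A]_(m, n)) :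
  mx_continuous C -> mx_continuous D -> mx_continuous (fun t => C t + D t).
Proof.
by move=> cC cD i j; under eq_fun do rewrite mxE; exact: nadd_continuous.
Qed.

Lemma mx_continuous_rmx m n (phi : R -> R) (M : 'M[A]_(m, n)) :
  continuous phi -> mx_continuous (fun t => rmx (phi t) M).
Proof.
by move=> cphi i j; under eq_fun do rewrite rmxE; exact: real_scale_continuous.
Qed.

Definition mx_loop m n (C : R -> 'M[A]_(m, n)) : 'M[loops A]_(m, n) :=
  \matrix_(i, j) glue (fun t => C t i j).

Definition mx_at m n z (M : 'M[loops A]_(m, n)) : 'M[A]_(m, n) :=
  map_mx (fun f : loops A => f z) M.

Lemma mx_atE m n z (M : 'M[loops A]_(m, n)) i j : mx_at z M i j = M i j z.
Proof. by rewrite mxE. Qed.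

Lemma mx_loopE m n (C : R -> 'M[A]_(m, n)) t : mx_continuous C ->
  C 0 = C (2 * pi) -> 0 <= t <= 2 * pi -> mx_at (cis t) (mx_loop C) = C t.
Proof.
by move=> cC C02 t02; apply/matrixP => i j; rewrite mx_atE mxE glueE// C02.
Qed.

Lemma loop_sumE (I : Type) (r : seq I) (F : I -> loops A) z :
  (\sum_(i <- r) F i) z = \sum_(i <- r) F i z.
Proof. by elim: r => [|i r IH]; rewrite ?big_nil// !big_cons -IH. Qed.

Lemma mx_atM m n k z (M : 'M[loops A]_(m, n)) (N : 'M[loops A]_(n, k)) :
  mx_at z (M *m N) = mx_at z M *m mx_at z N.
Proof.
apply/matrixP => i j; rewrite mx_atE !mxE loop_sumE; apply: eq_bigr => l _.
by rewrite !mx_atE.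
Qed.

Lemma mx_atB m n z (M N : 'M[loops A]_(m, n)) :
  mx_at z (M - N) = mx_at z M - mx_at z N.
Proof. by apply/matrixP => i j; rewrite !(mx_atE, mxE). Qed.

Lemma mx_at_adj m n z (M : 'M[loops A]_(m, n)) :
  mx_at z (adjmx M) = adjmx (mx_at z M).
Proof. by apply/matrixP => i j; rewrite adjmxE !mx_atE adjmxE. Qed.

Lemma mx_at_tr n z (M : 'M[loops A]_n) : \tr M z = \tr (mx_at z M).
Proof. by rewrite /mxtrace loop_sumE; apply: eq_bigr => i _; rewrite mx_atE. Qed.

Lemma mx_at_dsum10 n z : mx_at z (dsum 1%:M 0 : 'M[loops A]_(n + n)) = dsum 1%:M 0.
Proof.
rewrite /mx_at /dsum map_block_mx; congr block_mx; apply/matrixP => i j; rewrite !mxE//.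
by case: eqP.
Qed.

Lemma mx_loop_eq m n (M N : 'M[loops A]_(m, n)) :
  (forall t, 0 <= t <= 2 * pi -> mx_at (cis t) M = mx_at (cis t) N) -> M = N.
Proof.
move=> MN; apply/matrixP => i j; apply: loop_eqP => t /andP[t0 t2].
by rewrite -!mx_atE MN// t0 ltW.
Qed.

End MatrixLoops.

(** * Equivalence of projections *)

Section Equivalence.
Variables (R : realType) (A : cstarAlgType R).

Lemma projection_dsum10 n : projection (dsum 1%:M 0 : 'M[A]_(n + n)).
Proof.
split; last by rewrite /dsum adjmx_block adjmx1 !adjmx0.
by rewrite /dsum mulmx_block !mul0mx !mulmx0 mul1mx !addr0.
Qed.

Lemma mvn_dsum k l k' l' (p : 'M[A]_k) (q : 'M[A]_l) (p' : 'M[A]_k') (q' : 'M[A]_l') :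
  mvn_equiv p q -> mvn_equiv p' q' -> mvn_equiv (dsum p p') (dsum q q').
Proof.
move=> [v [<- <-]] [v' [<- <-]]; exists (block_mx v 0 0 v').
by rewrite /dsum adjmx_block !adjmx0 !mulmx_block !mul0mx !mulmx0 !addr0 !add0r.
Qed.

Lemma mvn_refl k (p : 'M[A]_k) : projection p -> mvn_equiv p p.
Proof. by move=> [pp pa]; exists p; rewrite pa pp. Qed.

Lemma K0_eq_mvn k l (p p' : 'M[A]_k) (q : 'M[A]_l) : projection q ->
  mvn_equiv p p' -> K0_eq p q p' q.
Proof.
move=> qq pp'; have r0 : projection (0 : 'M[A]_0).
  by split; [rewrite mul0mx|rewrite adjmx0].
by exists 0%N, 0; split=> //; do 2 (apply: mvn_dsum; last exact: mvn_refl).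
Qed.

End Equivalence.

(** * The clutching loop and its smooth reparametrization *)

Section ClutchingLoop.
Variables (R : realType) (A : cstarAlgType R) (n : nat) (u : 'M[A]_n).
Hypothesis hu : unitary u.

Definition column_at t := column u (cos (t / 4) ^+ 2) (sin (t / 4) ^+ 2)
  (cos (t / 4) * sin (t / 4)).

Lemma column_atK t : adjmx (column_at t) *m column_at t = 1%:M.
Proof. by apply: column_isometry => //; [exact: cos2Dsin2|ring]. Qed.

Lemma column_at0 : column_at 0 = column1 A n.
Proof.
by rewrite /column_at /column mul0r cos0 sin0 mulr0 expr1n expr0n rmx1 !rmx0l !addr0.
Qed.

Lemma column_at2pi : column_at (2 * pi) = column2 u.
Proof.
have -> : column_at (2 * pi) = column u (cos (pi / 2) ^+ 2) (sin (pi / 2) ^+ 2)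
    (cos (pi / 2) * sin (pi / 2)).
  by rewrite /column_at (_ : 2 * pi / 4 = pi / 2) //; field.
by rewrite cos_pihalf sin_pihalf /column mul0r expr0n expr1n rmx1 !rmx0l addr0 add0r.
Qed.

Lemma column_at_continuous (f : R -> R) : continuous f ->
  mx_continuous (fun t => column_at (f t)).
Proof.
move=> cf; have cf4 : continuous (fun t => f t / 4).
  by move=> t; apply: cvgM; [exact: cf|exact: cvg_cst].
have cc : continuous (fun t => cos (f t / 4)).
  by move=> t; exact: (continuous_comp (cf4 t) (@continuous_cos R _)).
have cs : continuous (fun t => sin (f t / 4)).
  by move=> t; exact: (continuous_comp (cf4 t) (@continuous_sin R _)).
have mc (g h : R -> R) : continuous g -> continuous h -> continuous (fun t => g t * h t).
  by move=> cg ch t; apply: cvgM; [exact: cg|exact: ch].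
by do !apply: mx_continuousD; apply: mx_continuous_rmx;
  do ?[under eq_fun do rewrite expr2]; exact: mc.
Qed.

(** The reparametrization of [0, 2 pi] that makes the clutching loop smooth at the
base point. *)
Definition slowed (t : R) : R := 2 * pi * step t.

Lemma real_smooth_slowed : real_smooth (slowed : R -> R).
Proof. by move=> k; apply: real_CkM; [exact: real_Ck_cst|exact: real_smooth_step]. Qed.

Lemma slowed_le0 t : t <= 0 -> slowed t = 0.
Proof. by move=> t0; rewrite /slowed step_le0// mulr0. Qed.

Lemma slowed_ge2pi t : 2 * pi <= t -> slowed t = 2 * pi.
Proof. by move=> t0; rewrite /slowed step_ge2pi// mulr1. Qed.

Let xx (t : R) : R := cos (slowed t / 4) ^+ 2.
Let yy (t : R) : R := sin (slowed t / 4) ^+ 2.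
Let zz (t : R) : R := cos (slowed t / 4) * sin (slowed t / 4).

Lemma real_smooth_weights : [/\ real_smooth xx, real_smooth yy & real_smooth zz].
Proof.
have s4 : real_smooth (fun t => slowed t / 4).
  by move=> k; apply: real_CkM; [exact: real_smooth_slowed|exact: real_Ck_cst].
have sc : real_smooth (fun t => cos (slowed t / 4)).
  by move=> k; apply: real_Ck_comp s4 => j; have [] := real_Ck_sin_cos R j.
have ss : real_smooth (fun t => sin (slowed t / 4)).
  by move=> k; apply: real_Ck_comp s4 => j; have [] := real_Ck_sin_cos R j.
by split=> k; rewrite /xx /yy /zz; do ?[under eq_fun do rewrite expr2]; exact: real_CkM.
Qed.

Lemma weights_le0 t : t <= 0 -> yy t = 0 /\ zz t = 0.
Proof. by move=> t0; rewrite /yy /zz slowed_le0// mul0r sin0 mulr0 expr0n. Qed.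

Lemma weights_ge2pi t : 2 * pi <= t -> [/\ xx t = 0, yy t = 1 & zz t = 0].
Proof.
move=> t0; rewrite /xx /yy /zz slowed_ge2pi// (_ : 2 * pi / 4 = pi / 2); last by field.
by rewrite cos_pihalf sin_pihalf mul0r expr0n expr1n.
Qed.

(** The reparametrized weights jump from (0, 1, 0) to (1, 0, 0) at the base point of
the circle, but their pairwise products vanish to infinite order
there, so these products descend to smooth functions on the circle. *)
Lemma weight_products :
  [/\ real_smooth (fun t => xx t * yy t) /\ supported (fun t => xx t * yy t),
      real_smooth (fun t => xx t * zz t) /\ supported (fun t => xx t * zz t) &
      real_smooth (fun t => yy t * zz t) /\ supported (fun t => yy t * zz t)].
Proof.
have [sx sy sz] := real_smooth_weights.
split; split=> [k|t [/weights_le0[y0 z0]|/weights_ge2pi[x0 _ z0]]];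
  by [exact: real_CkM | rewrite ?y0 ?z0 ?mulr0 ?mul0r | rewrite ?x0 ?z0 ?mulr0 ?mul0r].
Qed.

Definition clutching_loop : 'M[loops A]_(n + n) := mx_loop (clutching_projection u).

Definition smooth_clutching_loop : 'M[loops A]_(n + n) :=
  mx_loop (fun t => column_at (slowed t) *m adjmx (column_at (slowed t))).

Lemma continuous_idfun : continuous (fun t : R => t).
Proof. by move=> t; exact: cvg_id. Qed.

Lemma slowed_continuous : continuous (slowed : R -> R).
Proof. exact: real_smooth_continuous real_smooth_slowed. Qed.

Lemma clutching_loopE t : 0 <= t <= 2 * pi ->
  mx_at (cis t) clutching_loop = clutching_projection u t.
Proof.
move=> t02; rewrite /clutching_loop.
have -> : clutching_projection u = fun s => column_at s *m adjmx (column_at s).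
  by apply/funext => s; exact: clutching_column.
apply: mx_loopE t02; last first.
  by rewrite column_at0 column_at2pi column1_range column2_range.
apply: mx_continuousM; last apply: mx_continuous_adj;
  exact: (column_at_continuous continuous_idfun).
Qed.

Lemma smooth_clutching_loopE t : 0 <= t <= 2 * pi ->
  mx_at (cis t) smooth_clutching_loop = column_at (slowed t) *m adjmx (column_at (slowed t)).
Proof.
apply: mx_loopE; last first.
  by rewrite slowed_le0// slowed_ge2pi// column_at0 column_at2pi column1_range column2_range.
by apply: mx_continuousM; last apply: mx_continuous_adj;
  exact: column_at_continuous slowed_continuous.
Qed.

(** The partial isometry V_(rho theta) V_theta^* is a loop although V is not: at both
ends it is the range projection of V. *)
Lemma clutching_loop_mvn : mvn_equiv clutching_loop smooth_clutching_loop.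
Proof.
pose v := mx_loop (fun t => column_at (slowed t) *m adjmx (column_at t)).
have vE t : 0 <= t <= 2 * pi ->
    mx_at (cis t) v = column_at (slowed t) *m adjmx (column_at t).
  apply: mx_loopE; last first.
    by rewrite slowed_le0// slowed_ge2pi// column_at0 column_at2pi column1_range column2_range.
  apply: mx_continuousM; last apply: mx_continuous_adj.
    exact: column_at_continuous slowed_continuous.
  exact: (column_at_continuous continuous_idfun).
exists v; split; apply: mx_loop_eq => t t02; rewrite mx_atM mx_at_adj vE//.
  rewrite clutching_loopE// clutching_column// -/(column_at t) adjmxM adjmxK.
  by rewrite !mulmxA -(mulmxA (column_at t)) column_atK mulmx1.
rewrite smooth_clutching_loopE// adjmxM adjmxK.
by rewrite !mulmxA -(mulmxA _ (adjmx (column_at t))) column_atK mulmx1.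
Qed.

Lemma smooth_clutching_projection : projection smooth_clutching_loop.
Proof.
split; apply: mx_loop_eq => t t02; rewrite ?mx_atM ?mx_at_adj smooth_clutching_loopE//.
  by rewrite !mulmxA -(mulmxA _ (adjmx _) (column_at _)) column_atK mulmx1.
by rewrite adjmxM adjmxK.
Qed.

Lemma smooth_clutching_loop_entry i j : smooth_clutching_loop i j =
  loop_cst ((dsum 1%:M 0 : 'M[A]_(n + n)) i j) +
  scalar_loop A (fun t => xx t * yy t) * loop_cst (coef0 u i j) +
  scalar_loop A (fun t => xx t * zz t) * loop_cst (coef1 u i j) +
  scalar_loop A (fun t => yy t * zz t) * loop_cst (coef2 u i j).
Proof.
have [sx sy sz] := real_smooth_weights.
have sm := real_smooth_continuous.
apply: loop_eqP => t /andP[t0 /ltW t2].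
have lE (phi psi : R -> R) : real_smooth phi -> real_smooth psi ->
   phi 0 * psi 0 = phi (2 * pi) * psi (2 * pi) ->
   scalar_loop A (fun t => phi t * psi t) (cis t) = (phi t * psi t)%:C *: 1.
  move=> sphi spsi e; rewrite /scalar_loop glueE ?t0 ?t2 ?e//.
  by apply: real_scale_continuous; apply: sm => k; exact: real_CkM.
have [y0 z0] := weights_le0 (lexx 0); have [x2 y2 z2] := weights_ge2pi (lexx _).
rewrite -mx_atE smooth_clutching_loopE ?t0 ?t2// column_projection//; [|exact: cos2Dsin2|ring].
rewrite -[cos _ ^+ 2]/(xx t) -[sin _ ^+ 2]/(yy t) -[cos _ * sin _]/(zz t).
rewrite [LHS]mxE [X in X + _]mxE [X in X + _ + _]mxE !rmxE /=.
rewrite !lE//; try by rewrite ?y0 ?z0 ?x2 ?z2 ?mulr0 ?mul0r.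
by rewrite -!scalerAl !mul1r.
Qed.

End ClutchingLoop.
(** * Smoothness of the reparametrized loop *)

Section SmoothMatrices.
Variables (R : realType) (G : lieData R 1) (A : cstarAlgType R).
Variables (alpha : cstar_action G A).

Lemma action0 g : alpha g 0 = 0.
Proof. by rewrite -(scale0r 0) actionZ !scale0r. Qed.

Lemma actionN g a : alpha g (- a) = - alpha g a.
Proof. by rewrite -scaleN1r actionZ scaleN1r. Qed.

Lemma action_sum g (I : Type) (r : seq I) (F : I -> A) :
  alpha g (\sum_(i <- r) F i) = \sum_(i <- r) alpha g (F i).
Proof. by elim/big_rec2: _ => [|i a b _ <-]; rewrite ?action0// actionD. Qed.

Definition act_mx m n g (M : 'M[A]_(m, n)) := map_mx (alpha g) M.

Lemma act_mxM m n k g (M : 'M[A]_(m, n)) (N : 'M[A]_(n, k)) :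
  act_mx g (M *m N) = act_mx g M *m act_mx g N.
Proof.
apply/matrixP => i j; rewrite !mxE action_sum; apply: eq_bigr => l _.
by rewrite actionM !mxE.
Qed.

Lemma act_mx_adj m n g (M : 'M[A]_(m, n)) : act_mx g (adjmx M) = adjmx (act_mx g M).
Proof. by apply/matrixP => i j; rewrite !mxE action_star. Qed.

Lemma act_mx1 n g : act_mx g (1%:M : 'M[A]_n) = 1%:M.
Proof. by apply/matrixP => i j; rewrite !mxE; case: eqP; rewrite ?action_unit ?action0. Qed.

Lemma act_mx_unitary n g (u : 'M[A]_n) : unitary u -> unitary (act_mx g u).
Proof. by move=> [h1 h2]; split; rewrite -act_mx_adj -act_mxM ?h1 ?h2 act_mx1. Qed.

Lemma act_mx_column n g (u : 'M[A]_n) x y z :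
  act_mx g (column u x y z) = column (act_mx g u) x y z.
Proof.
rewrite !columnE /act_mx map_col_mx -!/(act_mx g _); congr col_mx.
  apply/matrixP => i j; rewrite !mxE actionD !actionZ; congr (_ *: _ + _).
  by case: eqP; rewrite ?action_unit ?action0.
rewrite -act_mx_adj; apply/matrixP => i j; rewrite !mxE actionZ actionD; congr (_ *: (_ + _)).
by rewrite actionN; case: eqP; rewrite ?action_unit ?action0.
Qed.

Lemma smooth_mx_adj m n (M : 'M[A]_(m, n)) : smooth_mx alpha M -> smooth_mx alpha (adjmx M).
Proof.
by move=> sM i j; rewrite adjmxE; apply: smooth_elt_star => // g; rewrite action_star.
Qed.

Lemma smooth_elt0 : smooth_elt alpha 0.
Proof. by apply: smooth_elt_fixed => g; rewrite action0. Qed.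

Lemma smooth_mxM m n k (M : 'M[A]_(m, n)) (N : 'M[A]_(n, k)) :
  smooth_mx alpha M -> smooth_mx alpha N -> smooth_mx alpha (M *m N).
Proof.
move=> sM sN i j; rewrite mxE; elim/big_ind: _ => [|a b sa sb|l _].
- exact: smooth_elt0.
- by apply: smooth_eltD => // g; rewrite actionD.
- by apply: smooth_eltM => // g; rewrite actionM.
Qed.

Lemma smooth_mxD m n (M N : 'M[A]_(m, n)) :
  smooth_mx alpha M -> smooth_mx alpha N -> smooth_mx alpha (M + N).
Proof. by move=> sM sN i j; rewrite mxE; apply: smooth_eltD => // g; rewrite actionD. Qed.

Lemma smooth_mx_fixed m n (M : 'M[A]_(m, n)) :
  (forall g, act_mx g M = M) -> smooth_mx alpha M.
Proof.
by move=> gM i j; apply: smooth_elt_fixed => g; rewrite -[in RHS](gM g) mxE.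
Qed.

Lemma smooth_mxN m n (M : 'M[A]_(m, n)) : smooth_mx alpha M -> smooth_mx alpha (- M).
Proof.
move=> sM i j; rewrite mxE -mulN1r; apply: smooth_eltM => [g||//]; first by rewrite actionM.
by apply: smooth_elt_fixed => g; rewrite actionN action_unit.
Qed.

Lemma smooth_mx_col m1 m2 n (M : 'M[A]_(m1, n)) (N : 'M[A]_(m2, n)) :
  smooth_mx alpha M -> smooth_mx alpha N -> smooth_mx alpha (col_mx M N).
Proof. by move=> sM sN i j; rewrite mxE; case: fintype.split. Qed.

Lemma act_mx0 m n g : act_mx g (0 : 'M[A]_(m, n)) = 0.
Proof. by apply/matrixP => i j; rewrite !mxE action0. Qed.

Lemma act_mx_dsum10 n g : act_mx g (dsum 1%:M 0 : 'M[A]_(n + n)) = dsum 1%:M 0.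
Proof. by rewrite /dsum /act_mx map_block_mx -!/(act_mx g _) act_mx1 !act_mx0. Qed.

Lemma smooth_coefs n (u : 'M[A]_n) : smooth_mx alpha u ->
  [/\ smooth_mx alpha (coef0 u), smooth_mx alpha (coef1 u) & smooth_mx alpha (coef2 u)].
Proof.
move=> su.
have s0 m1 m2 : smooth_mx alpha (0 : 'M[A]_(m1, m2)).
  by apply: smooth_mx_fixed => g; exact: act_mx0.
have s1 : smooth_mx alpha (1%:M : 'M[A]_n) by apply: smooth_mx_fixed => g; exact: act_mx1.
have c1 : smooth_mx alpha (column1 A n) by exact: smooth_mx_col.
have c2 : smooth_mx alpha (column2 u) by exact: smooth_mx_col.
have c3 : smooth_mx alpha (column3 u).
  apply: smooth_mx_col => //; apply: smooth_mxD; last exact: smooth_mxN.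
  exact: smooth_mx_adj.
have P : smooth_mx alpha (dsum 1%:M 0 : 'M[A]_(n + n)).
  by apply: smooth_mx_fixed => g; exact: act_mx_dsum10.
have cc (M N : 'M[A]_(n + n, n)) : smooth_mx alpha M -> smooth_mx alpha N ->
    smooth_mx alpha (M *m adjmx N).
  by move=> sM sN; apply: smooth_mxM => //; exact: smooth_mx_adj.
split; rewrite /coef0 /coef1 /coef2; last by apply: smooth_mxD; exact: cc.
  do ![apply: smooth_mxD]; try exact: cc.
  by apply: smooth_mxN; exact: smooth_mxD.
by apply: smooth_mxD; exact: cc.
Qed.

Lemma smooth_mx_smooth_clutching_loop n (u : 'M[A]_n) : unitary u -> smooth_mx alpha u ->
  smooth_mx (susp_action alpha) (smooth_clutching_loop u).
Proof.
move=> hu su i j; rewrite smooth_clutching_loop_entry//.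
have [s0 s1 s2] := smooth_coefs su.
have P := smooth_mx_fixed (act_mx_dsum10 n).
have [[sxy xy0] [sxz xz0] [syz yz0]] := weight_products R.
have D := smooth_eltD (fun g => susp_actionD alpha g _ _).
have M := smooth_eltM (fun g => susp_actionM alpha g _ _).
have C a : smooth_elt alpha a -> smooth_elt (susp_action alpha) (loop_cst a).
  exact: smooth_elt_loop_cst.
apply: (D _ _); [apply: (D _ _); [apply: (D _ _); [exact: (C _ (P i j))|]|]|];
  by apply: (M _ _); [exact: smooth_elt_scalar_loop|exact: (C _ _)].
Qed.

End SmoothMatrices.
(** * The curvature of the reparametrized loop *)

Section SuspensionDerivations.
Variables (R : realType) (G : lieData R 1) (hG : is_lie_group G) (A : cstarAlgType R).
Variables (X : R -> G) (hX : one_parameter_subgroup X) (alpha : cstar_action G A).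

Let Y := susp_basis (fun _ : 'I_1 => X).
Let l : 'I_(1 + 1) := lshift 1 ord0.
Let r : 'I_(1 + 1) := rshift 1 ord0.

Lemma susp_basis_l t : Y l t = (X t, 1%g).
Proof. by rewrite /Y /susp_basis (unsplitK (inl ord0)). Qed.

Lemma susp_basis_r t : Y r t = (1%g, cis t).
Proof. by rewrite /Y /susp_basis (unsplitK (inr ord0)). Qed.

Lemma susp_action_lE t (f : loops A) z :
  susp_action alpha (Y l t) f z = alpha (X t) (f z).
Proof. by rewrite susp_basis_l /= invg1 mulg1. Qed.

Lemma susp_action_rE t (f : loops A) z :
  susp_action alpha (Y r t) f z = f (z * (cis t)^-1)%g.
Proof. by rewrite susp_basis_r /= action1. Qed.

(** Existence of the limit defining the derivation. Its value is found afterwards by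
evaluation at the points of the circle. *)
Definition differentiable_along i (f : loops A) :=
  exists d, curve_deriv (fun t => susp_action alpha (Y i t) f) d.

Lemma differentiable_alongD i f g :
  differentiable_along i f -> differentiable_along i g -> differentiable_along i (f + g).
Proof.
move=> [d fd] [e ge]; exists (d + e); have := curve_derivD fd ge.
by under eq_fun do rewrite -susp_actionD.
Qed.

Lemma differentiable_alongM i f g :
  differentiable_along i f -> differentiable_along i g -> differentiable_along i (f * g).
Proof.
move=> [d fd] [e ge]; eexists; have := curve_derivM fd ge.
by under eq_fun do rewrite -susp_actionM; apply.
Qed.

Lemma differentiable_along_cst i a : smooth_elt alpha a -> differentiable_along i (loop_cst a).
Proof.
move=> sa; case: (ord2_cases i) => ->.
  exists (loop_cst (derivation alpha X a)).
  have := curve_deriv_loop_cst (smooth_elt_deriv hG hX sa).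
  by congr curve_deriv; apply/funext => t; rewrite susp_basis_l susp_action_cst.
exists 0; have := @curve_deriv_cst _ (loops A) (loop_cst a).
congr curve_deriv; apply/funext => t.
by rewrite susp_basis_r susp_action_cst action1.
Qed.

Lemma differentiable_along_scalar_loop i phi : real_smooth phi -> supported phi ->
  differentiable_along i (scalar_loop A phi).
Proof.
move=> sp su; have cp := real_smooth_continuous sp; case: (ord2_cases i) => ->.
  exists 0; have := @curve_deriv_cst _ (loops A) (scalar_loop A phi).
  congr curve_deriv; apply/funext => t; rewrite susp_basis_l -(cis0 R).
  by rewrite susp_action_scalar_loop// rot0.
have [d fd _] := rot_Ck_scalar_loop A 1 sp su; exists d; move: fd.
congr curve_deriv; apply/funext => t.
by rewrite susp_basis_r susp_action_scalar_loop.
Qed.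

Lemma differentiable_along_clutching i n (u : 'M[A]_n) :
  unitary u -> smooth_mx alpha u ->
  forall j k, differentiable_along i (smooth_clutching_loop u j k).
Proof.
move=> hu su j k; rewrite smooth_clutching_loop_entry//.
have [s0 s1 s2] := smooth_coefs su.
have P := smooth_mx_fixed (act_mx_dsum10 alpha n).
have [[sxy xy0] [sxz xz0] [syz yz0]] := weight_products R.
apply: differentiable_alongD; [apply: differentiable_alongD; [apply: differentiable_alongD|]|].
  exact: (differentiable_along_cst i (P j k)).
all: by apply: differentiable_alongM;
  [exact: differentiable_along_scalar_loop|exact: differentiable_along_cst].
Qed.

Lemma curve_deriv_eval (C : R -> loops A) d z : curve_deriv C d ->
  curve_deriv (fun t => C t z) (d z).
Proof.
move=> /ncvgP Cd; apply/ncvgP => e /Cd; apply: filterS => t.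
by apply: le_lt_trans; exact: (loop_norm_ub (diff_quot (C : R -> normed (loops A)) t - d) z).
Qed.

Let D i n (M : 'M[loops A]_n) := map_mx (derivation (susp_action alpha) (Y i)) M.

Lemma mx_deriv_eval i n (M : 'M[loops A]_n) z :
  (forall j k, differentiable_along i (M j k)) ->
  mx_deriv (fun t => \matrix_(j, k) susp_action alpha (Y i t) (M j k) z)
    (mx_at z (D i M)).
Proof.
move=> dM j k; rewrite mx_atE mxE; under eq_fun do rewrite mxE.
apply: curve_deriv_eval; have [d Md] := dM j k.
by rewrite /derivation (curve_deriv_lim Md).
Qed.

Variables (n : nat) (u : 'M[A]_n).
Hypotheses (hu : unitary u) (su : smooth_mx alpha u).

Let d := map_mx (derivation alpha X) u.
Let p := smooth_clutching_loop u.

Lemma mx_deriv_unitary : mx_deriv (fun t => act_mx alpha (X t) u) d.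
Proof.
move=> i j; rewrite mxE; under eq_fun do rewrite mxE.
exact: smooth_elt_deriv.
Qed.

Lemma act_mx_X0 m k (M : 'M[A]_(m, k)) : act_mx alpha (X 0) M = M.
Proof. by apply/matrixP => i j; rewrite mxE (one_parameter_subgroup0 hX) action1. Qed.

Lemma unitary_deriv : adjmx d *m u + adjmx u *m d = 0.
Proof.
have := mx_deriv_isometry _ mx_deriv_unitary; rewrite act_mx_X0; apply => t.
by case: (act_mx_unitary alpha (X t) hu).
Qed.

Definition column_deriv y z : 'M[A]_(n + n, n) := col_mx (rmx y d) (rmx z (adjmx d)).

Lemma mx_deriv_column_act x y z :
  mx_deriv (fun t => act_mx alpha (X t) (column u x y z)) (column_deriv y z).
Proof.
apply: (@mx_deriv_ext _ _ _ _ (fun t => column (act_mx alpha (X t) u) x y z)).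
  by move=> t; rewrite act_mx_column.
apply: (@mx_deriv_ext _ _ _ _ (fun t => col_mx (rmx x 1%:M + rmx y (act_mx alpha (X t) u))
  (rmx z (adjmx (act_mx alpha (X t) u) - 1%:M)))).
  by move=> t; rewrite columnE.
have dd := mx_deriv_unitary.
rewrite /column_deriv -(add0r (rmx y d)) -(addr0 (adjmx d)).
apply: mx_deriv_col; first by apply: mx_derivD; [exact: mx_deriv_cst|exact: mx_deriv_rmx].
apply: mx_deriv_rmx; apply: mx_derivD; last exact: mx_deriv_cst.
exact: mx_deriv_adj.
Qed.

(** At a point of the circle the derivative of p = V V^* along the flow is computed
from the curve t |-> alpha_t (V) alpha_t (V)^*. The second equation differentiates
V^* V = 1. *)
Lemma derivation_l_at s : 0 <= s <= 2 * pi ->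
  let V := column_at u (slowed s) in
  let V1 := column_deriv (sin (slowed s / 4) ^+ 2) (cos (slowed s / 4) * sin (slowed s / 4)) in
  mx_at (cis s) (D l p) = V1 *m adjmx V + V *m adjmx V1 /\
  adjmx V1 *m V + adjmx V *m V1 = 0.
Proof.
move=> s02 V V1.
have VV1 : mx_deriv (fun t => act_mx alpha (X t) V) V1 by exact: mx_deriv_column_act.
split; last first.
  have := mx_deriv_isometry _ VV1; rewrite act_mx_X0; apply => t.
  by rewrite -act_mx_adj -act_mxM column_atK// act_mx1.
have := mx_deriv_range_projection VV1; rewrite act_mx_X0.
apply: mx_deriv_unique.
have := mx_deriv_eval (z := cis s) (differentiable_along_clutching l hu su).
apply: mx_deriv_ext => t; apply/matrixP => i j.
rewrite mxE susp_action_lE -mx_atE smooth_clutching_loopE//.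
by rewrite -act_mx_adj -act_mxM [RHS]mxE.
Qed.

(** The same with the curve t |-> V (s - t), whence the signs. The point [s] is
interior because V is not a loop: V (s - t) gives the value of [p] at the angle
s - t only when this lies in [0, 2 pi]. *)
Lemma derivation_r_at s x' y' z' : 0 < s < 2 * pi ->
  is_derive s 1 (fun t => cos (slowed t / 4) ^+ 2) x' ->
  is_derive s 1 (fun t => sin (slowed t / 4) ^+ 2) y' ->
  is_derive s 1 (fun t => cos (slowed t / 4) * sin (slowed t / 4)) z' ->
  let V := column_at u (slowed s) in
  let V2 := column u (- x') (- y') (- z') in
  mx_at (cis s) (D r p) = V2 *m adjmx V + V *m adjmx V2 /\
  adjmx V2 *m V + adjmx V *m V2 = 0.
Proof.
move=> /andP[s0 s2] dx dy dz V V2.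
have flip (phi : R -> R) e : is_derive s 1 phi e -> is_derive (0:R) 1 (fun t => phi (s - t)) (- e).
  move=> dphi; have dl : is_derive (0:R) 1 (fun t => s - t) (- 1).
    by apply: is_derive_eq (is_deriveB (is_derive_cst _ _ _) (is_derive_id _ _)) _; rewrite sub0r.
  rewrite -mulrN1; apply: (@is_derive1_comp _ phi (fun t => s - t)) => //.
  by rewrite subr0.
have VV2 : mx_deriv (fun t => column_at u (slowed (s - t))) V2.
  have H phi e (M : 'M[A]_(n + n, n)) : is_derive s 1 phi e ->
      mx_deriv (fun t => rmx (phi (s - t)) M) (rmx (- e) M).
    move=> /flip /(mx_deriv_real (M := M)); apply: mx_deriv_ext => t.
    by rewrite add0r.
  by apply: mx_derivD; [apply: mx_derivD|]; [exact: H dx|exact: H dy|exact: H dz].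
have VE : column_at u (slowed (s - 0)) = V by rewrite subr0.
split; last first.
  by have := mx_deriv_isometry _ VV2; rewrite VE; apply => t; exact: column_atK.
have := mx_deriv_range_projection VV2; rewrite VE.
apply: mx_deriv_unique.
move=> i j; have := @mx_deriv_eval r _ p (cis s) (differentiable_along_clutching r hu su) i j.
have E t : 0 <= s - t <= 2 * pi ->
    (\matrix_(j, k) susp_action alpha (Y r t) (p j k) (cis s)) i j =
    (column_at u (slowed (s - t)) *m adjmx (column_at u (slowed (s - t)))) i j.
  by move=> st; rewrite mxE susp_action_rE cisV -cisD -mx_atE smooth_clutching_loopE.
apply: curve_deriv_near; first by apply: E; rewrite subr0 !ltW.
have : \forall t \near (0:R)^', `|t| < Num.min s (2 * pi - s).
  by apply: dnbhs0_lt; rewrite lt_min s0 subr_gt0.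
apply: filterS => t; rewrite lt_min !ltr_norml => /andP[/andP[t1 t2] /andP[t3 t4]].
by apply: E; apply/andP; split; lra.
Qed.

Variable tau : A -> R[i].
Hypothesis htau : is_trace alpha tau.

Lemma trace_unitary_deriv : tau (\tr d) = 0 /\ tau (\tr (adjmx d)) = 0.
Proof.
split.
  apply: (mxtrace_deriv htau mx_deriv_unitary) => t i.
  by rewrite !mxE !(trace_invariant htau).
apply: (mxtrace_deriv htau (mx_deriv_adj mx_deriv_unitary)) => t i.
by rewrite !adjmxE !mxE -!action_star !(trace_invariant htau).
Qed.

(** Only the terms with u^* d or u d^*, and their adjoints, contribute: the trace of d
vanishes, and the derivative of u^* u = 1 makes the traces of u^* d and d^* u
opposite. *)
Lemma trace_column_deriv y z a b c :
  let V1 := column_deriv y z in let V2 := column u a b c in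
  tau (\tr (adjmx V1 *m V2)) - tau (\tr (adjmx V2 *m V1)) =
  (2 * (z * c - y * b))%:C * tau (\tr (adjmx u *m d)).
Proof.
move=> V1 V2; have [td tdd] := trace_unitary_deriv.
have ud : tau (\tr (adjmx d *m u)) = - tau (\tr (adjmx u *m d)).
  apply/eqP; rewrite -addr_eq0 -(mxtrace_D htau) unitary_deriv.
  by rewrite raddf0 (trace0 htau).
have e1 : adjmx V1 *m V2 = rmx (y * a) (adjmx d) + rmx (y * b) (adjmx d *m u) +
    (rmx (z * c) (d *m adjmx u) - rmx (z * c) d).
  rewrite /V1 /V2 columnE adjmx_col !adjmx_rmx adjmxK mul_row_col !(rmxMl, rmxMr).
  by rewrite !mulmxDr !mulmxN !mulmx1 !(rmxMr, rmxDr, rmxA, rmxNr) !mulmx1.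
have e2 : adjmx V2 *m V1 = rmx (y * a) d + rmx (y * b) (adjmx u *m d) +
    (rmx (z * c) (u *m adjmx d) - rmx (z * c) (adjmx d)).
  rewrite /V1 /V2 adjmx_column mul_row_col mulmxDl !(rmxMl, rmxMr) mulmxDl mulNmx !mul1mx.
  by rewrite !(rmxDr, rmxA, rmxNr) (mulrC y a) (mulrC y b) (mulrC z c).
rewrite e1 e2 !(mxtrace_D htau) !(mxtrace_N htau) !(mxtrace_rmx htau) td tdd.
rewrite (mxtraceC htau d) (mxtraceC htau u) ud !mulr0 !add0r !subr0.
rewrite !(rmorphM, rmorphB); ring.
Qed.

Lemma chern_density s x' y' z' : 0 < s < 2 * pi ->
  is_derive s 1 (fun t => cos (slowed t / 4) ^+ 2) x' ->
  is_derive s 1 (fun t => sin (slowed t / 4) ^+ 2) y' ->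
  is_derive s 1 (fun t => cos (slowed t / 4) * sin (slowed t / 4)) z' ->
  tau (\tr (p *m (D l p *m D r p - D r p *m D l p)) (cis s)) =
  (2 * (sin (slowed s / 4) ^+ 2 * y' - cos (slowed s / 4) * sin (slowed s / 4) * z'))%:C *
    tau (\tr (adjmx u *m d)).
Proof.
move=> /[dup] s02 /andP[s0 s2] dx dy dz.
have s02' : 0 <= s <= 2 * pi by rewrite !ltW.
have [e1 h1] := derivation_l_at s02'.
have [e2 h2] := derivation_r_at s02 dx dy dz.
rewrite mx_at_tr mx_atM mx_atB !mx_atM e1 e2 smooth_clutching_loopE//.
rewrite (projection_curvature htau (column_atK hu _) h1 h2) trace_column_deriv.
by congr (_%:C * _); ring.
Qed.

End SuspensionDerivations.
(** * Integration over the circle *)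

Section IntegralOverCircle.
Variables (R : realType) (A : cstarAlgType R) (tau : A -> R[i]).

Lemma susp_trace_ext (f g : loops A) : (forall z, tau (f z) = tau (g z)) ->
  susp_trace tau f = susp_trace tau g.
Proof.
by move=> fg; congr (_%:C + _ * _%:C); apply: eq_Rintegral => t _; rewrite fg.
Qed.

Lemma susp_trace0 : tau 0 = 0 -> susp_trace tau 0 = 0.
Proof.
move=> t0; have int0 (P : R[i] -> R) : P 0 = 0 ->
    \int[lebesgue_measure]_(t in `[0, 2 * pi]) P (tau ((0 : loops A) (cis t))) = 0.
  move=> P0; under eq_Rintegral => t _ do rewrite /= t0 P0.
  by rewrite Rintegral_cst//= mul0r.
by rewrite /susp_trace !int0// mulr0 addr0.
Qed.

Lemma Re_continuous : continuous (@complex.Re R : R[i]^o -> R).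
Proof.
move=> z B /nbhs_ballP[e /= e0 eB]; exists e%:C; first by rewrite /= ltcR.
move=> w; rewrite /ball_ /= => zw; apply: eB; rewrite /ball /= -ltcR -raddfB.
exact: le_lt_trans (normc_ge_Re _) zw.
Qed.

Lemma Im_continuous : continuous (@complex.Im R : R[i]^o -> R).
Proof.
move=> z B /nbhs_ballP[e /= e0 eB]; exists e%:C; first by rewrite /= ltcR.
move=> w; rewrite /ball_ /= => zw; apply: eB; rewrite /ball /= -ltcR -raddfB.
apply: le_lt_trans zw; case: (z - w) => a b.
by rewrite normc_def lecR /= -sqrtr_sqr ler_wsqrtr// lerDr sqr_ge0.
Qed.

(** Fundamental theorem of calculus for a density that is known only at interior
points. *)
Lemma integral_density (h g g' : R -> R) (c : R) : continuous h ->
  (forall x : R, is_derive x 1 g (g' x)) ->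
  (forall t, 0 < t < 2 * pi -> h t = g' t * c) ->
  \int[lebesgue_measure]_(t in `[0, 2 * pi]) h t = (g (2 * pi) - g 0) * c.
Proof.
move=> ch dg hg; have pi0 : 0 < 2 * pi :> R by rewrite mulr_gt0// pi_gt0.
have dG (t : R) : is_derive t 1 (fun t => g t * c) (g' t * c).
  apply: is_derive_eq (is_deriveM (dg t) (is_derive_cst c _ _)) _.
  by rewrite /GRing.scale /= mulr0 add0r mulrC.
have cG : continuous (fun t => g t * c).
  by move=> t; apply/differentiable_continuous/derivable1_diffP; case: (dG t).
rewrite /Rintegral (continuous_FTC2 (F := fun t => g t * c) pi0).
- by rewrite -EFinB /= mulrBl.
- exact: continuous_subspaceT.
- split; first by move=> t _; case: (dG t).
  + exact: cvg_at_right_filter (cG 0).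
  + exact: cvg_at_left_filter (cG (2 * pi)).
move=> t; rewrite in_itv /= => /hg ->.
by rewrite derive1E (@derive_val _ _ _ _ _ _ _ (dG t)).
Qed.

Lemma susp_trace_density (f : loops A) (g g' : R -> R) (c : R[i]) :
  continuous (tau : normed A -> R[i]^o) ->
  (forall x : R, is_derive x 1 g (g' x)) ->
  (forall t, 0 < t < 2 * pi -> tau (f (cis t)) = (g' t)%:C * c) ->
  susp_trace tau f = (g (2 * pi) - g 0)%:C * c.
Proof.
move=> ctau dg fg.
have cf : continuous ((fun t => tau (f (cis t))) : R -> R[i]^o).
  move=> t; have c1 := continuous_comp (@cis_continuous R t) (@loop_continuous _ _ f (cis t)).
  exact: (continuous_comp c1 (ctau (f (cis t)))).
have cRe : continuous (fun t => complex.Re (tau (f (cis t)))).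
  by move=> t; exact: (continuous_comp (cf t) (@Re_continuous _)).
have cIm : continuous (fun t => complex.Im (tau (f (cis t)))).
  by move=> t; exact: (continuous_comp (cf t) (@Im_continuous _)).
rewrite /susp_trace (integral_density (c := complex.Re c) cRe dg); last first.
  by move=> t /fg ->; case: c {fg} => a b /=; rewrite mul0r subr0.
rewrite (integral_density (c := complex.Im c) cIm dg); last first.
  by move=> t /fg ->; case: c {fg} => a b /=; rewrite mul0r addr0.
rewrite {3}[c]complexE mulrDr !rmorphM; ring.
Qed.

End IntegralOverCircle.

(** * The character of a unitary *)

Section Conclusion.
Variables (R : realType) (G : lieData R 1) (hG : is_lie_group G) (A : cstarAlgType R).
Variables (X : R -> G) (hX : one_parameter_subgroup X) (alpha : cstar_action G A).
Variables (tau : A -> R[i]) (htau : is_trace alpha tau).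
Variables (n : nat) (u : 'M[A]_n) (hu : unitary u) (hsu : smooth_mx alpha u).

Let Y := susp_basis (fun _ : 'I_1 => X).
Let q : 'M[loops A]_(n + n) := dsum 1%:M 0.
Let p := smooth_clutching_loop u.
Let T := tau (\tr (adjmx u *m map_mx (derivation alpha X) u)).
Let D i (M : 'M[loops A]_(n + n)) := map_mx (derivation (susp_action alpha) (Y i)) M.

(** The trace of V V^* is that of V^* V = 1. *)
Lemma susp_trace_rank : susp_trace tau (\tr p) = susp_trace tau (\tr q).
Proof.
apply: susp_trace_ext => z; have [t t02 <-] := cis_surj z.
rewrite !mx_at_tr smooth_clutching_loopE// mx_at_dsum10 -column1_range.
rewrite (mxtraceC htau (column_at _ _)) (mxtraceC htau (column1 A n)) column_atK//.
by rewrite /column1 adjmx_col adjmx1 adjmx0 mul_row_col mul1mx mul0mx addr0.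
Qed.

Lemma derivation_dsum10 i : D i q = 0.
Proof.
apply/matrixP => j k; rewrite mxE [RHS]mxE.
have e t : susp_action alpha (Y i t) (q j k) = q j k.
  apply: loopP => z /=; rewrite -!mx_atE /q !mx_at_dsum10.
  by have /matrixP/(_ j k) := act_mx_dsum10 alpha n (Y i t).1; rewrite mxE.
apply: curve_deriv_lim; under eq_fun do rewrite e.
exact: curve_deriv_cst.
Qed.

Lemma smooth_dsum10 : smooth_mx (susp_action alpha) q.
Proof.
move=> j k; apply: smooth_elt_fixed => g; apply: loopP => z /=.
rewrite -!mx_atE /q !mx_at_dsum10.
by have /matrixP/(_ j k) := act_mx_dsum10 alpha n g.1; rewrite mxE.
Qed.

(** The density is the derivative of y^2 - z^2, that is of
sin^4 - cos^2 sin^2 at a quarter of the reparametrized angle, which is 0 at 0 and 1 at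
2 pi. *)
Lemma susp_trace_curvature (l := lshift 1 (ord0 : 'I_1)) (r := rshift 1 (ord0 : 'I_1)) :
  susp_trace tau (\tr (p *m (D l p *m D r p - D r p *m D l p))) = T.
Proof.
have [sx sy sz] := real_smooth_weights R.
have [x' dx _] := real_smooth_deriv sx.
have [y' dy _] := real_smooth_deriv sy.
have [z' dz _] := real_smooth_deriv sz.
pose y t : R := sin (slowed t / 4) ^+ 2; pose z t : R := cos (slowed t / 4) * sin (slowed t / 4).
pose g t := y t * y t - z t * z t.
have dg (t : R) : is_derive t 1 g (2 * (y t * y' t - z t * z' t)).
  apply: is_derive_eq (is_deriveB (is_deriveM (dy t) (dy t)) (is_deriveM (dz t) (dz t))) _.
  by rewrite /GRing.scale /= /y /z; ring.
rewrite (susp_trace_density (c := T) (@trace_continuous _ _ _ _ _ _ htau) dg); last first.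
  move=> t t02; exact: (chern_density hG hX hu hsu htau t02 (dx t) (dy t) (dz t)).
have [y0 z0] := weights_le0 (lexx (0 : R)); have [_ y2 z2] := weights_ge2pi (lexx (2 * pi : R)).
by rewrite /g /y /z y0 z0 y2 z2 !mulr0 !mulr1 !subr0 mul1r.
Qed.

(** The final comparison, with [b] and [b'] for degrees 0 and 2. *)
Lemma degreewise_difference (b b' : bool) (k r r' c c' t : R[i]) :
  r = r' -> c = t -> c' = 0 -> (b -> ~~ b') ->
  (if b then r else if b' then k * c else 0) -
  (if b then r' else if b' then k * c' else 0) - (if b' then k * t else 0) = 0.
Proof.
move=> -> -> ->; case: b => [/(_ isT)/negbTE ->|_]; first by rewrite !subrr.
by case: b'; rewrite ?mulr0 ?subr0 ?subrr.
Qed.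

Lemma chern_odd_unitary :
  is_chern_odd alpha tau (fun _ : 'I_1 => X) u
    (wedge (form0 1 ((2 * pi%:C * 'i%C)^-1 * T)) (dual_basis R[i] [set ord0]%SET)).
Proof.
have pq : projection q by exact: projection_dsum10.
exists (clutching_loop u); split.
  by move=> t t02; rewrite -clutching_loopE.
exists (n + n)%N, (n + n)%N, p, q; split.
- by split; [exact: smooth_clutching_projection|exact: smooth_mx_smooth_clutching_loop].
- by split=> //; exact: smooth_dsum10.
- by apply: K0_eq_mvn => //; exact: clutching_loop_mvn.
have tau0 := susp_trace0 (trace0 htau).
exists 0; rewrite [RHS](_ : _ = 0); last first.
  rewrite /ce_diff big1// => S _; rewrite big1// => k _.
  apply/ffunP => U; rewrite ffunE big1 ?ffunE// => V _.
  by rewrite !ffunE mul0r if_same mul0r mulr0.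
apply/ffunP => S.
have sub (f g h : Defs.form (1 + 1) R[i]) a b c :
    f S = a -> g S = b -> h S = c -> (f - g - h) S = a - b - c.
  by move=> <- <- <-; rewrite !ffunE.
have pE := @chern_formE _ _ _ (susp_action alpha) (susp_trace tau) Y tau0 _ p S.
have qE := @chern_formE _ _ _ (susp_action alpha) (susp_trace tau) Y tau0 _ q S.
have wE := @chern_target _ ((2 * pi%:C * 'i%C)^-1 * T) S.
apply: etrans (sub _ _ _ _ _ _ pE qE wE) _; rewrite [RHS]ffunE {sub pE qE wE}.
apply: degreewise_difference; [exact: susp_trace_rank|exact: susp_trace_curvature| |].
  rewrite [X in q *m X](_ : _ = 0) ?mulmx0 ?raddf0//.
  by rewrite -!/(D _ q) !derivation_dsum10 mulmx0 subrr.
by move=> /eqP ->.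
Qed.

End Conclusion.

Unset Implicit Arguments.
Set Strict Implicit.
Set Printing Implicit Defensive.

(* the right-hand side is c X^*, X^* the basis of H^1(g) = g^* dual to X *)
Theorem mainTheorem1 (R : realType) (A : cstarAlgType R) (G : lieData R 1)
    (hG : is_lie_group G) (X : R -> G) (hX : is_lie_basis (fun _ : 'I_1 => X))
    (alpha : cstar_action G A) (tau : A -> R[i]) (htau : is_trace alpha tau)
    (n : nat) (u : 'M[A]_n) (hu : unitary u) (hsu : smooth_mx alpha u) :
  is_chern_odd alpha tau (fun _ : 'I_1 => X) u
    (wedge
       (form0 1 ((2 * pi%:C * 'i%C)^-1 *
                 tau (\tr (adjmx u *m map_mx (derivation alpha X) u))))
       (dual_basis R[i] [set ord0]%SET)).
Proof.
exact: (chern_odd_unitary hG (hX.1 ord0) htau hu hsu).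
Qed.
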